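(* Let $\Pi$ be an EFC process with characteristics $(c_k,\nu_{Coag},c_e,\nu_{Disl})$ that coalesces quickly, i.e. such that $\int_{\mathcal S^\downarrow}\big(\sum_ix_i\big)\nu_{Coag}(dx)=\infty$ or $c_k>0$, and let $\rho$ be its unique stationary probability measure on $\mathcal P$. Then $$\rho(\{\pi\in\mathcal P:\mathrm{dust}(\pi)\neq\emptyset\})=0 .$$
   Context: Partitions. $\mathbb N=\{1,2,\dots\}$, $[n]=\{1,\dots,n\}$. $\mathcal P$ (resp. $\mathcal P_n$) is the set of partitions of $\mathbb N$ (resp. $[n]$); $\pi=(B_1,B_2,\dots)$ lists the blocks in increasing order of least element (followed by empty blocks if there are finitely many). $i\overset{\pi}{\sim}j$ means $i,j$ are in the same block of $\pi$; $\pi_{|[n]}$ is the restriction to $[n]$; $\#\pi$ is the number of non-empty blocks; $\mathbf 0$ is the partition into singletons, $\mathbf 1$ the one-block partition, $\mathbf 0_n,\mathbf 1_n$ their restrictions to $[n]$. $\mathcal P$ carries the compact metric $d(\pi,\pi')=1/\max\{n:\pi_{|[n]}=\pi'_{|[n]}\}$ ($0$ if $\pi=\pi'$). For a permutation $\sigma$, $\sigma(\pi)$ is defined by $i\overset{\sigma(\pi)}{\sim}j\iff\sigma(i)\overset{\pi}{\sim}\sigma(j)$. A random partition or $\mathcal P$-valued process is exchangeable if its law is invariant under every permutation $\sigma$ of $\mathbb N$ with $\sigma(n)=n$ for all large $n$. Dust. For $A\subseteq\mathbb N$, $\|A\|=\lim_{n}\frac1n\#(A\cap[n])$ when the limit exists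 (asymptotic frequency). $\mathrm{dust}(\pi)=\bigcup_{j:\|B_j\|=0}B_j$. For an exchangeable random partition, a.s. all blocks have asymptotic frequencies and $\mathrm{dust}(\pi)=\{i\in\mathbb N:\{i\}\text{ is a block of }\pi\}$. Operators. For $\pi=(B_i)$, $\pi'=(B'_j)$: $Coag(\pi,\pi')$ has blocks $\bigcup_{i\in B'_j}B_i$; $Frag(\pi,\pi',k)$ keeps every $B_i$, $i\ne k$, and replaces $B_k$ by the non-empty sets $B_k\cap B'_j$. For $\pi\in\mathcal P_n$, $Coag(\pi,\pi')$ is defined likewise for $\pi'\in\mathcal P_{\#\pi}$, and for $\pi'\in\mathcal P_{|B_k|}$, $Frag(\pi,\pi',k)$ is defined by identifying $B_k$ with $[|B_k|]$ via the increasing bijection. EFC processes. An EFC (exchangeable fragmentation-coalescence) process is an exchangeable $\mathcal P$-valued Markov process $(\Pi(t))_{t\ge0}$ whose restrictions $\Pi_{|[n]}$ are càdlàg finite-state Markov chains whose transition rates $q_n(\pi,\pi')$ are non-zero only if $\pi'=Coag(\pi,\pi'')$ for some $\pi''$ or $\pi'=Frag(\pi,\pi'',k)$ for some $\pi'',k$. Characteristics. $\mathcal S^\downarrow=\{x=(x_1\ge x_2\ge\dots\ge0):\sum_i x_i\le1\}$. For $x\in\mathcal S^\downarrow$, $\mu_x$ is the law of the partition with $i\sim j\iff X_i=X_j$, where the $X_i$ are independent, $P(X_i=k)=x_k$ ($k\ge1$), $P(X_i=-i)=1-\sum_jx_j$; $\mu_\nu=\int\mu_x\,\nu(dx)$.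 $\mathbf e=\sum_n\delta_{\epsilon_n}$, $\epsilon_n$ having blocks $\{n\}$, $\mathbb N\setminus\{n\}$; $\kappa=\sum_{i<j}\delta_{\epsilon_{i,j}}$, $\epsilon_{i,j}$ having $\{i,j\}$ as only non-singleton block. Characteristics are $c_k,c_e\ge0$ and measures $\nu_{Coag},\nu_{Disl}$ on $\mathcal S^\downarrow$ with $\nu_{Coag}(\{(0,0,\dots)\})=0$, $\int\sum_ix_i^2\,\nu_{Coag}(dx)<\infty$, $\nu_{Disl}(\{(1,0,\dots)\})=0$, $\int(1-\sum_ix_i^2)\,\nu_{Disl}(dx)<\infty$. With $C=c_k\kappa+\mu_{\nu_{Coag}}$ and $F=c_e\mathbf e+\mu_{\nu_{Disl}}$, an EFC process has these characteristics if, for $\pi\in\mathcal P_n$ with $m$ blocks, $q_n(\pi,Coag(\pi,\pi'))=C(\{\pi'':\pi''_{|[m]}=\pi'\})$ for $\pi'\in\mathcal P_m\setminus\{\mathbf 0_m\}$, $q_n(\pi,Frag(\pi,\pi',k))=F(\{\pi'':\pi''_{|[|B_k|]}=\pi'\})$ for $\pi'\in\mathcal P_{|B_k|}\setminus\{\mathbf 1_{|B_k|}\}$, and all other rates vanish. Every EFC process has unique characteristics, and when these are not all zero it has a unique stationary probability measure $\rho$ on $\mathcal P$, which is exchangeable; the image of $\rho$ under $\pi\mapsto\pi_{|[n]}$ is the unique stationary distribution of the chain with rates $q_n$. *)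

(* Defs.v *)
From HB Require Import structures.
From mathcomp Require Import all_boot all_order all_algebra finmap.
From mathcomp Require Import all_classical all_reals all_analysis.

Set Implicit Arguments.
Unset Strict Implicit.
Unset Printing Implicit Defensive.

Import Order.TTheory GRing.Theory Num.Theory.
Import numFieldNormedType.Exports.

Local Open Scope classical_set_scope.
Local Open Scope ring_scope.

(* Indices are 0-based: the set N = {1, 2, ...} is rendered by nat and
   [n] = {1, ..., n} by 'I_n, the integer i being represented by i - 1.
   Blocks are numbered from 0 as well. *)

(* A partition of T, given by the relation "being in the same block". *)
Record part (T : Type) := Part {
  sim :> T -> T -> Prop ;
  sim_refl : forall i, sim i i ;
  sim_sym : forall i j, sim i j -> sim j i ;
  sim_trans : forall i j k, sim i j -> sim j k -> sim i k }.

Lemma part_eqP T (p p' : part T) : (forall i j, p i j <-> p' i j) -> p = p'.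
Proof.
case: p p' => [r r1 r2 r3] [s s1 s2 s3] /= rs.
have E : r = s by apply/funext => i; apply/funext => j; apply/propext.
by subst s; congr Part; exact: Prop_irrelevance.
Qed.

Section part_basic.
Context {T : Type}.

Definition part0 : part T :=
  @Part T (fun i j => i = j) (fun=> erefl) (fun _ _ => @esym _ _ _)
    (fun _ _ _ => @etrans _ _ _ _).

Definition part1 : part T :=
  @Part T (fun _ _ => True) (fun=> I) (fun _ _ _ => I) (fun _ _ _ _ _ => I).

Definition part_comap (T' : Type) (f : T -> T') (p : part T') : part T :=
  @Part T (fun i j => p (f i) (f j)) (fun=> sim_refl p _)
    (fun _ _ => @sim_sym _ p _ _) (fun _ _ _ => @sim_trans _ p _ _ _).

End part_basic.

(* On part nat, the sigma-algebra generated by the events {i ~ j} is the Borel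
   sigma-algebra of the metric d(p, p') = 1/max {n : p|[n] = p'|[n]}: its
   balls are the countably many cylinders {p' : p'|[n] = p|[n]}.
   On part 'I_n it is the discrete sigma-algebra. *)
Definition sim_events (T : Type) : set (set (part T)) :=
  [set A | exists i j, A = [set p : part T | p i j]].

Definition part_display : measure_display. Proof. exact. Qed.

HB.instance Definition _ (T : Type) := gen_eqMixin (part T).
HB.instance Definition _ (T : Type) := gen_choiceMixin (part T).
HB.instance Definition _ (T : Type) := isPointed.Build (part T) part0.
HB.instance Definition _ (T : Type) :=
  @isMeasurable.Build part_display (part T) <<s @sim_events T >>
    (@sigma_algebra0 _ _ _) (@sigma_algebraC _ _) (@sigma_algebra_bigcup _ _ _).

Definition restr (n : nat) (p : part nat) : part 'I_n :=
  part_comap (@nat_of_ord n) p.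

(* i ~ j in part_perm s p iff s i ~ s j in p *)
Definition part_perm (s : nat -> nat) (p : part nat) : part nat :=
  part_comap s p.

Definition finite_perm (s : nat -> nat) : Prop :=
  bijective s /\ \forall n \near \oo, s n = n.

Section blocks.
Context {disp : Order.disp_t} {T : orderType disp}.
Implicit Types p : part T.

Definition is_least p (i : T) : Prop := forall j, p i j -> (i <= j)%O.

(* The blocks whose least element is smaller than every element of the block
   of i come before it in the listing by increasing least element. *)
Definition blocks_before p (i : T) : set T :=
  [set l | is_least p l /\ forall j, p i j -> (l < j)%O].

(* Used for T = nat and T = 'I_n, where blocks_before p i is finite. *)
Definition block_index p (i : T) : nat := #|` fset_set (blocks_before p i)|%fset.

(* Empty when k is at least the number of blocks. *)
Definition block p (k : nat) : set T := [set i | block_index p i = k].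

Lemma blocks_before_sim p i j : p i j -> blocks_before p i = blocks_before p j.
Proof.
move=> pij; apply/seteqP; split=> l [lp lt]; split=> // k pk; apply: lt.
  exact: sim_trans pij pk.
exact: sim_trans (sim_sym pij) pk.
Qed.

Lemma block_index_sim p i j : p i j -> block_index p i = block_index p j.
Proof. by move=> pij; rewrite /block_index (blocks_before_sim pij). Qed.

End blocks.

Section finite_operators.
Context {n : nat}.
Implicit Types p : part 'I_n.

Definition nblocks p : nat := #|` fset_set [set i | is_least p i]|%fset.

Lemma block_index_lt p (i : 'I_n) : (block_index p i < nblocks p)%N.
Proof.
have ii : `[< p i i >] by apply/asboolP; exact: sim_refl.
case: (@arg_minnP _ i (fun j => `[< p i j >]) (@nat_of_ord n) ii) => l.
move=> /asboolP pil lmin; apply: fproper_ltn_card; rewrite fproperE.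
apply/andP; split.
  apply/fsubsetP => k.
  by rewrite !in_fset_set; [move=> /set_mem [lk _]; exact/mem_set |
    exact: finite_finset..].
apply/fsubsetPn; exists l; rewrite in_fset_set; try exact: finite_finset.
  apply/mem_set => j plj; apply: lmin; apply/asboolP; exact: sim_trans pil plj.
by apply/negP => /set_mem [_ /(_ l pil)]; rewrite ltxx.
Qed.

Definition block_ord p (i : 'I_n) : 'I_(nblocks p) :=
  Ordinal (block_index_lt p i).

(* The block B'_j of p' gives the union of the B_i, i in B'_j: two points are
   together iff the indices of their blocks are together in p'. *)
Definition coag p (p' : part 'I_(nblocks p)) : part 'I_n :=
  part_comap (block_ord p) p'.

Definition block_set p (k : nat) : {set 'I_n} :=
  [set i | block_index p i == k]%SET.

(* enum_val lists the elements of block_set p k in increasing order: it is the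
   increasing bijection from [|B_k|] to B_k. *)
Definition frag_sim p (k : nat) (p' : part 'I_#|block_set p k|) (i j : 'I_n) :
    Prop :=
  p i j /\ (i \in block_set p k ->
    exists a b : 'I_#|block_set p k|,
      [/\ enum_val a = i, enum_val b = j & p' a b]).

Lemma frag_sim_refl p k (p' : part 'I_#|block_set p k|) i : frag_sim p' i i.
Proof.
split=> [|ik]; first exact: sim_refl.
exists (enum_rank_in ik i), (enum_rank_in ik i).
by split; [exact: enum_rankK_in..| exact: sim_refl].
Qed.

Lemma frag_sim_sym p k (p' : part 'I_#|block_set p k|) i j :
  frag_sim p' i j -> frag_sim p' j i.
Proof.
move=> [pij H]; split=> [|jk]; first exact: sim_sym.
have /H [a [b [ai bj pab]]] : i \in block_set p k.
  by move: jk; rewrite !inE (block_index_sim pij).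
by exists b, a; split=> //; exact: sim_sym.
Qed.

Lemma frag_sim_trans p k (p' : part 'I_#|block_set p k|) i j l :
  frag_sim p' i j -> frag_sim p' j l -> frag_sim p' i l.
Proof.
move=> [pij H1] [pjl H2]; split=> [|ik]; first exact: sim_trans pij pjl.
have jk : j \in block_set p k by move: ik; rewrite !inE (block_index_sim pij).
have [a [b [ai bj pab]]] := H1 ik; have [c [e [cj el pce]]] := H2 jk.
have bc : b = c by apply: enum_val_inj; rewrite bj cj.
by exists a, e; split=> //; apply: sim_trans pab _; rewrite bc.
Qed.

Definition frag p (k : nat) (p' : part 'I_#|block_set p k|) : part 'I_n :=
  @Part _ (frag_sim p') (frag_sim_refl p') (@frag_sim_sym p k p')
    (@frag_sim_trans p k p').

Definition is_coag (p r : part 'I_n) : Prop :=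
  exists p' : part 'I_(nblocks p), r = coag p'.

Definition is_frag (p r : part 'I_n) : Prop :=
  exists k (p' : part 'I_#|block_set p k|), r = frag p'.

End finite_operators.

Section dust.
Variable R : realType.

Definition has_freq (A : set nat) (l : R) : Prop :=
  (fun n => (#|` fset_set (A `&` `I_n)|%fset)%:R / n%:R : R) @ \oo --> l.

Definition dust (p : part nat) : set nat :=
  \bigcup_(k in [set k | has_freq (block p k) 0]) block p k.

End dust.

(* The set S of nonincreasing sequences with nonnegative terms and sum <= 1. *)
Record massp (R : realType) := Massp {
  mass :> nat -> R ;
  mass_nonincr : forall i j, (i <= j)%N -> mass j <= mass i ;
  mass_ge0 : forall i, 0 <= mass i ;
  mass_le1 : (\sum_(0 <= i <oo) (mass i)%:E <= 1)%E }.

Section massp_structure.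
Variable R : realType.

Definition massp0 : massp R.
Proof.
apply: (@Massp R (fun=> 0)) => //.
by rewrite eseries0.
Defined.

Definition massp1 : massp R.
Proof.
apply: (@Massp R (fun i => (i == 0%N)%:R)) => [[|i] [|j] //|i|].
- by rewrite ler0n.
- by rewrite (nneseries_split _ 1)//= big_nat1 eseries0 ?adde0//; case.
Defined.

Definition massp_coord_events : set (set (massp R)) :=
  [set A | exists i (B : set R), measurable B /\ A = [set x : massp R | B (x i)]].

End massp_structure.

Definition massp_display : measure_display. Proof. exact. Qed.

HB.instance Definition _ (R : realType) := gen_eqMixin (massp R).
HB.instance Definition _ (R : realType) := gen_choiceMixin (massp R).
HB.instance Definition _ (R : realType) := isPointed.Build (massp R) (massp0 R).
HB.instance Definition _ (R : realType) :=
  @isMeasurable.Build massp_display (massp R) <<s @massp_coord_events R >>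
    (@sigma_algebra0 _ _ _) (@sigma_algebraC _ _) (@sigma_algebra_bigcup _ _ _).

Section characteristics.
Variable R : realType.
Local Open Scope ereal_scope.

Definition mass_sum (x : massp R) : \bar R := \sum_(0 <= i <oo) (x i)%:E.

Definition mass_sum2 (x : massp R) : \bar R := \sum_(0 <= i <oo) (x i ^+ 2)%:E.

Definition independent_int d (Omega : measurableType d) (Pr : probability Omega R)
    (X : nat -> Omega -> int) : Prop :=
  forall (J : {fset nat}) (A : nat -> set int),
    Pr (\bigcap_(i in [set` J]) (X i @^-1` A i)) =
    \prod_(i <- J) Pr (X i @^-1` A i).

(* M is the law mu_x: X i stands for X_{i+1}, and x k for x_{k+1}. *)
Definition is_paintbox_law (x : massp R) (M : probability (part nat) R) : Prop :=
  exists d (Omega : measurableType d) (Pr : probability Omega R)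
         (X : nat -> Omega -> int),
    [/\ (forall i (A : set int), measurable (X i @^-1` A)),
        independent_int Pr X,
        (forall i k, Pr (X i @^-1` [set (k.+1)%:Z]) = (x k)%:E),
        (forall i, Pr (X i @^-1` [set (- (i.+1)%:Z)%R]) = 1 - mass_sum x) &
        (forall A, measurable A ->
           M A = Pr ((fun w => part_comap (X ^~ w) part0) @^-1` A))].

(* Blocks {n} and N \ {n}. *)
Definition eps1 (n : nat) : part nat := part_comap (fun i => i == n) part0.

(* {i, j} is the only non-singleton block (for i <> j). *)
Definition eps2 (i j : nat) : part nat :=
  part_comap (fun a => if a == j then i else a) part0.

Definition erosion (A : set (part nat)) : \bar R :=
  \sum_(0 <= n <oo) \d_(eps1 n) A.

Definition kingman (A : set (part nat)) : \bar R :=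
  \esum_(ij in [set ij : nat * nat | (ij.1 < ij.2)%N]) \d_(eps2 ij.1 ij.2) A.

Definition coag_measure (mu : massp R -> probability (part nat) R) (ck : R)
    (nuC : {measure set (massp R) -> \bar R}) (A : set (part nat)) : \bar R :=
  ck%:E * kingman A + \int[nuC]_x mu x A.

Definition frag_measure (mu : massp R -> probability (part nat) R) (ce : R)
    (nuD : {measure set (massp R) -> \bar R}) (A : set (part nat)) : \bar R :=
  ce%:E * erosion A + \int[nuD]_x mu x A.

Record characteristics (ck : R) (nuC : {measure set (massp R) -> \bar R})
    (ce : R) (nuD : {measure set (massp R) -> \bar R}) : Prop := {
  char_ck : (0 <= ck)%R ;
  char_ce : (0 <= ce)%R ;
  char_nuC0 : nuC [set massp0 R] = 0 ;
  char_nuC : \int[nuC]_x mass_sum2 x < +oo ;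
  char_nuD1 : nuD [set massp1 R] = 0 ;
  char_nuD : \int[nuD]_x (1 - mass_sum2 x) < +oo }.

(* The transition rates q have the given characteristics. The law mu x is
   uniquely determined by x, so the existential merely names it. *)
Definition rates_have_characteristics
    (q : forall n, part 'I_n -> part 'I_n -> R)
    (ck : R) (nuC : {measure set (massp R) -> \bar R})
    (ce : R) (nuD : {measure set (massp R) -> \bar R}) : Prop :=
  exists2 mu : massp R -> probability (part nat) R,
    forall x, is_paintbox_law x (mu x) &
    forall n (p : part 'I_n),
      [/\ (forall p' : part 'I_(nblocks p), p' <> part0 ->
             (q n p (coag p'))%:E =
             coag_measure mu ck nuC [set r | restr (nblocks p) r = p']),
          (forall k (p' : part 'I_#|block_set p k|), p' <> part1 ->
             (q n p (frag p'))%:E =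
             frag_measure mu ce nuD [set r | restr #|block_set p k| r = p']) &
          (forall r, r <> p ->
             ~ (exists2 p' : part 'I_(nblocks p), p' <> part0 & r = coag p') ->
             ~ (exists k, exists2 p' : part 'I_#|block_set p k|,
                  p' <> part1 & r = frag p') ->
             q n p r = 0%R)].

End characteristics.

Section markov.
Variable R : realType.
Local Open Scope ereal_scope.

(* Times are the t : R with 0 <= t; values at negative times play no role. *)

Definition transition_semigroup d (T : measurableType d)
    (K : R -> R.-pker T ~> T) : Prop :=
  (forall x A, measurable A -> K 0%R x A = \d_x A) /\
  (forall s t x A, (0 <= s)%R -> (0 <= t)%R -> measurable A ->
     K (s + t)%R x A = \int[K s x]_y K t y A).

Definition past dO (Omega : measurableType dO) d (T : measurableType d)
    (X : R -> Omega -> T) (s : R) : set (set Omega) :=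
  <<s [set E | exists u (A : set T),
         [/\ (0 <= u)%R, (u <= s)%R, measurable A & E = X u @^-1` A]] >>.

(* Last clause: P(X_{s+t} in B | past s) = K_t(X_s, B) almost surely. *)
Definition markov_process dO (Omega : measurableType dO)
    (Pr : probability Omega R) d (T : measurableType d)
    (X : R -> Omega -> T) (K : R -> R.-pker T ~> T) : Prop :=
  [/\ transition_semigroup K,
      (forall t, (0 <= t)%R -> measurable_fun setT (X t)) &
      (forall s t E B, (0 <= s)%R -> (0 <= t)%R -> past X s E -> measurable B ->
         Pr (E `&` X (s + t)%R @^-1` B) = \int[Pr]_(w in E) K t (X s w) B)].

Definition has_rates d (S : measurableType d)
    (p : R -> R.-pker S ~> S) (q : S -> S -> R) : Prop :=
  forall a b, a <> b ->
    (fun h : R => fine (p h a [set b]) / h)%R @ 0%R^'+ --> q a b.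

Definition cadlag_discrete (S : Type) (x : R -> S) : Prop :=
  (forall t, (0 <= t)%R -> \forall u \near t^'+, x u = x t) /\
  (forall t, (0 < t)%R -> exists l, \forall u \near t^'-, x u = l).

Definition exchangeable_process dO (Omega : measurableType dO)
    (Pr : probability Omega R) (X : R -> Omega -> part nat) : Prop :=
  forall s, finite_perm s ->
  forall m (t : 'I_m -> R) (A : 'I_m -> set (part nat)),
    (forall i, (0 <= t i)%R) -> (forall i, measurable (A i)) ->
    Pr (\bigcap_i ((fun w => part_perm s (X (t i) w)) @^-1` A i)) =
    Pr (\bigcap_i (X (t i) @^-1` A i)).

(* Pi is an EFC process with transition semigroup K and rates q. The semigroup
   p of the chain Pi|[n] is the image of K under restriction; this is required
   from every starting point since K_t(x, -) would otherwise be arbitrary at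
   the states x which Pi does not visit. *)
Record EFC_process dO (Omega : measurableType dO) (Pr : probability Omega R)
    (Pi : R -> Omega -> part nat) (K : R -> R.-pker (part nat) ~> (part nat))
    (q : forall n, part 'I_n -> part 'I_n -> R) : Prop := {
  efc_exchangeable : exchangeable_process Pr Pi ;
  efc_markov : markov_process Pr Pi K ;
  efc_restr : forall n, exists p : R -> R.-pker (part 'I_n) ~> (part 'I_n),
    [/\ markov_process Pr (fun t w => restr n (Pi t w)) p,
        (forall t x A, (0 <= t)%R -> measurable A ->
           K t x (restr n @^-1` A) = p t (restr n x) A) &
        has_rates p (q n)] ;
  efc_cadlag : forall n,
    {ae Pr, forall w, cadlag_discrete (fun t => restr n (Pi t w))} ;
  efc_rates : forall n (a b : part 'I_n), a <> b -> q n a b <> 0%R ->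
    is_coag a b \/ is_frag a b }.

Definition stationary d (T : measurableType d)
    (K : R -> R.-pker T ~> T) (rho : probability T R) : Prop :=
  forall t A, (0 <= t)%R -> measurable A -> \int[rho]_x K t x A = rho A.

End markov.

(* Main.v *)
Require Import Defs.
From HB Require Import structures.
From mathcomp Require Import all_boot all_order all_algebra fingroup perm finmap.
From mathcomp Require Import all_classical all_reals all_analysis.
From mathcomp Require Import measurable_realfun.

Set Implicit Arguments.
Unset Strict Implicit.
Unset Printing Implicit Defensive.

Import Order.TTheory GRing.Theory Num.Theory.
Import numFieldNormedType.Exports.

Local Open Scope classical_set_scope.
Local Open Scope ring_scope.

(** Why a stationary law has no dust. Write [rho_n] for the image of the
    stationary law [rho] on the partitions of the first [n] points.

    The chain on [n] points has the stationary law [rho_n], so as much mass flows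
    per unit of time out of the set of states where point 0 is a singleton as
    flows into it ([stationary_balance]). The flow in is bounded uniformly in
    [n]: isolating point 0 means dislocating its block so that its two lowest
    points are separated, and the intensity of that is finite
    ([isolation_rate_le], [inflow_le]). The flow out of a state with [m] blocks
    is at least the intensity with which block 0 is merged with one of the
    [m - 1] others ([outflow_ge]), and this grows to infinity with [m] when the
    process coalesces quickly ([joining_rate_unbounded]). Hence the states that
    isolate point 0 and have at least [m] singletons, so at least [m] blocks, have
    small probability. In a state with fewer than [m] singletons, point 0 is one
    of them with probability at most [m / n] by exchangeability ([few_singles]).
    Letting [n], then [m], tend to infinity, [rho] almost surely has no singleton
    ([alone_null]).

    By exchangeability again, the block of [i], if it has frequency 0, contains
    any other given point with probability 0 ([null_freq_sim]). So almost surely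
    a block of frequency 0 would be a singleton, and there is none.

    Exchangeability of [rho] is not assumed. It is inherited from the process:
    the one-block partition can be reached from every state by coagulations
    ([coarsening_rate], [leads_part1]), so the laws of the restricted process,
    which are exchangeable, converge to [rho_n] along a sequence of times
    ([doeblin_cvg], [restr_law_act]).

    The measures [mu x] come without any regularity in [x]; since cylinder
    probabilities are explicit series in the masses ([paintbox_cylinder]) they are
    measurable in [x] ([measurable_paintbox]), which makes the intensities of
    cylinder events additive and continuous along increasing unions. *)

(** * Partitions of a finite set *)

(** A partition of a finite set is determined by a boolean matrix, which makes the
    partitions of ['I_n] a finite type and sums over them available. *)
Definition part_code n (p : part 'I_n) : {ffun 'I_n * 'I_n -> bool} :=
  [ffun ij => `[< p ij.1 ij.2 >]].

Lemma part_code_inj n : injective (@part_code n).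
Proof.
move=> p p' /ffunP pp'; apply: part_eqP => i j.
have := pp' (i, j); rewrite !ffunE /= => E.
by rewrite -[p i j]asboolE -[p' i j]asboolE E.
Qed.

Definition part_decode n (c : {ffun 'I_n * 'I_n -> bool}) : part 'I_n :=
  xget part0 [set p | part_code p = c].

Lemma part_codeK n : cancel (@part_code n) (@part_decode n).
Proof.
move=> p; apply: part_code_inj.
by apply: (@xgetPex _ part0 [set p' | part_code p' = part_code p]); exists p.
Qed.

HB.instance Definition _ n :=
  Choice_isCountable.Build (part 'I_n)
    (pcan_pickleK (can_pcan (@part_codeK n))).
HB.instance Definition _ n : fintype.isFinite (part 'I_n) :=
  CanIsFinite (@part_codeK n).


Lemma measurable_sim (T : Type) (i j : T) : measurable [set p : part T | p i j].
Proof. by apply: sub_sigma_algebra; exists i, j. Qed.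

Lemma measurable_part1 n (a : part 'I_n) : measurable [set a].
Proof.
have -> : [set a] = \bigcap_(ij in [set: 'I_n * 'I_n])
    (if `[< a ij.1 ij.2 >] then [set p : part 'I_n | p ij.1 ij.2]
     else ~` [set p : part 'I_n | p ij.1 ij.2]).
  apply/seteqP; split=> [p -> [i j] _ /=|p H]; first by case: asboolP.
  apply: part_eqP => i j; have := H (i, j) I => /=.
  by case: asboolP.
apply: fin_bigcap_measurable; first exact: finite_finset.
move=> ij _; case: ifP => _; first exact: measurable_sim.
by apply: measurableC; exact: measurable_sim.
Qed.

Lemma measurable_part n (D : set (part 'I_n)) : measurable D.
Proof.
have -> : D = \bigcup_(a in D) [set a].
  by apply/seteqP; split=> [p Dp|p [a Da ->]//]; exists p.
apply: fin_bigcup_measurable; first exact: finite_finset.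
by move=> a _; exact: measurable_part1.
Qed.

Lemma measurable_restr n : measurable_fun setT (restr n).
Proof.
apply: (measurability (@sim_events 'I_n)) => // _ [_ [i [j ->]] <-]; rewrite setTI.
exact: measurable_sim.
Qed.

Lemma measurable_cyl n (D : set (part 'I_n)) : measurable (restr n @^-1` D).
Proof.
rewrite -[X in measurable X]setTI.
exact: measurable_restr measurableT _ (measurable_part D).
Qed.

Lemma measure_fin_split (R : realType) d (T : measurableType d)
    (m : {measure set T -> \bar R}) (S : finType) (f : T -> S) (D : pred S) :
  (forall a, measurable (f @^-1` [set a])) ->
  m (f @^-1` [set a | D a]) = (\sum_(a | D a) m (f @^-1` [set a]))%E.
Proof.
move=> mf.
have -> : f @^-1` [set a | D a] = \bigcup_(a in [set a | D a]) f @^-1` [set a].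
  by apply/seteqP; split=> [t Dt|t [a Da] /= ->//]; exists (f t).
rewrite measure_fin_bigcup //; [|exact: finite_finset|].
  have -> : [set a | D a] = [set` enum D].
    by apply/seteqP; split=> a /=; rewrite mem_enum.
  by rewrite -fsbig_seq ?enum_uniq // big_enum.
by move=> a b _ _ [t [/= fa fb]]; rewrite -fa fb.
Qed.

(** * Blocks *)

Definition alone (T : Type) (p : part T) (i : T) := forall j, p i j -> j = i.

Section block_index_inj.
Context {disp : Order.disp_t} {T : orderType disp} (p : part T).
Hypothesis least : forall i, exists2 l, p i l & is_least p l.
Hypothesis fin : forall i, finite_set (blocks_before p i).

(** If the least element of the block of [i] is below that of the block of [j],
    it is counted in the index of [j] but not in that of [i], and everything
    counted for [i] is counted for [j]. *)
Lemma block_index_inj i j : block_index p i = block_index p j -> p i j.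
Proof.
have [l pil lmin] := least i; have [l' pjl l'min] := least j.
wlog ll' : i j l l' pil lmin pjl l'min / (l <= l')%O.
  move=> H E; case/orP: (le_total l l') => ll'; first exact: (H i j l l').
  by apply: sim_sym; exact: (H j i l' l).
move=> E; move: ll'; rewrite le_eqVlt => /orP[/eqP ll'|ll'].
  by apply: sim_trans pil _; rewrite ll'; exact: sim_sym.
suff : (block_index p i < block_index p j)%N by rewrite E ltnn.
apply: fproper_ltn_card; rewrite fproperE; apply/andP; split.
  apply/fsubsetP => k; rewrite !in_fset_set // !inE => -[kmin klt]; split=> //.
  move=> m pjm; apply: (lt_trans (klt _ pil)); apply: (lt_le_trans ll').
  by apply: l'min; exact: sim_trans (sim_sym pjl) pjm.
apply/fsubsetPn; exists l; rewrite in_fset_set // ?inE.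
  split=> // m pjm; apply: (lt_le_trans ll'); apply: l'min.
  exact: sim_trans (sim_sym pjl) pjm.
by apply/negP; rewrite inE => -[_ /(_ _ pil)]; rewrite ltxx.
Qed.

End block_index_inj.

Lemma block_index_nat (p : part nat) i j :
  block_index p i = block_index p j -> p i j.
Proof.
apply: block_index_inj => {i j} i.
  have ex : exists j, `[< p i j >] by exists i; apply/asboolP; exact: sim_refl.
  case: (ex_minnP ex) => l /asboolP pil lmin; exists l => // j plj.
  by rewrite leEnat; apply: lmin; apply/asboolP; exact: sim_trans pil plj.
apply: (sub_finite_set _ (finite_II i)) => l [_ /(_ i (sim_refl p i))].
by rewrite ltEnat.
Qed.

Section finite_blocks.
Variable n : nat.
Implicit Types p : part 'I_n.

Lemma least_ord p i : exists2 l, p i l & is_least p l.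
Proof.
have ii : `[< p i i >] by apply/asboolP; exact: sim_refl.
case: (@arg_minnP _ i (fun j => `[< p i j >]) (@nat_of_ord n) ii) => l.
move=> /asboolP pil lmin; exists l => // j plj.
by apply: lmin; apply/asboolP; exact: sim_trans pil plj.
Qed.

Lemma block_index_ord p i j : block_index p i = block_index p j -> p i j.
Proof.
by apply: block_index_inj => k; [exact: least_ord|exact: finite_finset].
Qed.

Lemma card_fset_set (T : finType) (A : set T) :
  #|` fset_set A|%fset = #|[set i | `[< A i >]]%SET|.
Proof.
rewrite cardE; apply: perm_size; apply: uniq_perm; rewrite ?enum_uniq //.
move=> i; rewrite mem_enum !inE in_fset_set; last exact: finite_finset.
by apply/idP/asboolP => [/set_mem|Ai //]; last exact/mem_set.
Qed.

Definition leasts p : {set 'I_n} := [set i | `[< is_least p i >]]%SET.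

Definition singles p : {set 'I_n} := [set i | `[< alone p i >]]%SET.

Lemma leastsP p i : reflect (is_least p i) (i \in leasts p).
Proof. by rewrite inE; exact: asboolP. Qed.

Lemma singlesP p i : reflect (alone p i) (i \in singles p).
Proof. by rewrite inE; exact: asboolP. Qed.

Lemma nblocksE p : nblocks p = #|leasts p|.
Proof. exact: card_fset_set. Qed.

Lemma least_eq p i j : is_least p i -> is_least p j -> p i j -> i = j.
Proof.
by move=> ip jp pij; apply: le_anti; rewrite ip //= jp //; exact: sim_sym.
Qed.

(** The labelling is injective on the least elements of blocks, of which there
    are exactly as many as labels. *)
Lemma block_ord_surj p (k : 'I_(nblocks p)) : exists i, block_ord p i = k.
Proof.
suff : k \in (block_ord p @: leasts p)%SET by move=> /imsetP[i _ ->]; exists i.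
suff -> : (block_ord p @: leasts p)%SET = [set: 'I_(nblocks p)]%SET by rewrite inE.
apply/eqP; rewrite eqEcard finset.subsetT cardsT card_ord.
rewrite card_in_imset -?nblocksE ?leqnn //.
move=> i j /leastsP il /leastsP jl /(congr1 val) /= E.
exact: least_eq il jl (block_index_ord E).
Qed.

Lemma card_singles_le p : (#|singles p| <= nblocks p)%N.
Proof.
rewrite nblocksE; apply: subset_leq_card; apply/fintype.subsetP => i /singlesP ia.
by apply/leastsP => j /ia ->.
Qed.

(** Distinct merging patterns of the blocks give distinct results: every label
    is the label of some block. *)
Lemma coag_inj p : injective (@coag n p).
Proof.
move=> p1 p2 E; apply: part_eqP => k l.
have [i <-] := block_ord_surj k; have [j <-] := block_ord_surj l.
by rewrite -[p1 _ _]/(coag p1 i j) E.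
Qed.

Lemma coag_coarser p (p' : part 'I_(nblocks p)) i j : p i j -> coag p' i j.
Proof.
move=> pij; rewrite /= (_ : block_ord p i = block_ord p j); first exact: sim_refl.
by apply: val_inj; exact: block_index_sim.
Qed.

Lemma coag_alone p (p' : part 'I_(nblocks p)) i :
  alone (coag p') i -> alone p' (block_ord p i).
Proof.
move=> ia k p'k; have [j E] := block_ord_surj k.
by rewrite -E (ia j) //= E.
Qed.

Lemma coag_part0 p (p' : part 'I_(nblocks p)) :
  p' <> part0 -> coag p' <> p.
Proof.
move=> p'0 E; apply: p'0; apply: part_eqP => k l.
have [i <-] := block_ord_surj k; have [j <-] := block_ord_surj l.
rewrite -[p' _ _]/(coag p' i j) E; split=> [pij|/(congr1 val)].
  by apply: val_inj; exact: block_index_sim.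
exact: block_index_ord.
Qed.

End finite_blocks.

Section block_of_zero.
Variable n : nat.
Implicit Types p : part 'I_n.+1.

Lemma block_index0 p : block_index p ord0 = 0%N.
Proof.
rewrite /block_index (_ : blocks_before p ord0 = set0) ?fset_set0 ?cardfs0 //.
by apply/seteqP; split=> // l [_ /(_ _ (sim_refl p ord0))].
Qed.

(** Only a dislocation of its own block can isolate the least point. In that
    block it has rank 0, so the dislocating partition separates ranks 0 and 1. *)
Lemma frag_isolates p k (p' : part 'I_#|block_set p k|) :
  ~ alone p ord0 -> alone (frag p') ord0 ->
  [/\ k = 0%N, (1 < #|block_set p k|)%N &
      forall a0 a1 : 'I_#|block_set p k|,
        nat_of_ord a0 = 0%N -> nat_of_ord a1 = 1%N -> ~ p' a0 a1].
Proof.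
move=> pa fa.
have [j pj j0] : exists2 j, p ord0 j & j <> ord0.
  apply: contrapT => H; apply: pa => j pj.
  by apply: contrapT => j0; apply: H; exists j.
have k0 : k = 0%N.
  apply: contrapT => k0; apply: j0; apply: fa; split=> //.
  by rewrite inE block_index0 => /eqP /esym.
have in0 : ord0 \in block_set p k by rewrite inE block_index0 k0.
have jk : j \in block_set p k.
  by rewrite inE -(block_index_sim pj) block_index0 k0.
split=> //.
  rewrite (cardsD1 ord0) in0 (cardsD1 j) !inE; move: jk; rewrite inE => ->.
  by move/eqP: j0 => ->.
move=> a0 a1 v0 v1 pa01.
have e0 : enum_val a0 = ord0.
  (* the enumeration of a set containing the least point starts with it *)
  rewrite /enum_val v0 /enum_mem.
  have -> : Finite.enum 'I_n.+1 = ord0 :: behead (Finite.enum 'I_n.+1).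
    by rewrite -enumT enum_ordSl.
  by rewrite /= in0.
have : enum_val a1 = ord0.
  apply: fa; split.
    apply: block_index_ord; rewrite block_index0.
    by have := enum_valP a1; rewrite inE => /eqP ->.
  by move=> _; exists a0, a1.
by rewrite -e0 => /enum_val_inj E; move: v0; rewrite -E v1.
Qed.

End block_of_zero.

(** * Paintbox partitions *)

Section measure_helpers.
Context d (T : measurableType d) (R : realType) (m : {measure set T -> \bar R}).

Lemma measure_mono (A B : set T) :
  measurable A -> measurable B -> A `<=` B -> (m A <= m B)%E.
Proof. by move=> mA mB; apply: le_measure; rewrite inE. Qed.

Lemma measure_disjoint_union (F : nat -> set T) :
  (forall k, measurable (F k)) -> (forall k l t, F k t -> F l t -> k = l) ->
  m (\bigcup_k F k) = (\sum_(0 <= k <oo) m (F k))%E.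
Proof.
move=> mF dF; apply: measure_semi_bigcup => //; last exact: bigcup_measurable.
by move=> k l _ _ [t [Fk Fl]]; exact: dF Fk Fl.
Qed.

End measure_helpers.

Section mass_functions.
Variable R : realType.
Implicit Types x : massp R.

Lemma measurable_mass k : measurable_fun setT (fun x : massp R => x k).
Proof.
move=> _ B mB; rewrite setTI; apply: sub_sigma_algebra.
by exists k, B.
Qed.

Lemma measurable_mass_sum : measurable_fun setT (fun x : massp R => mass_sum x).
Proof.
apply: (@ge0_emeasurable_sum _ _ _ _ (fun i x => (x i)%:E) xpredT) =>
  [k x _ _|k _].
  by rewrite lee_fin mass_ge0.
by apply/measurable_EFinP; exact: measurable_mass.
Qed.

Lemma measurable_mass_sum2 : measurable_fun setT (fun x : massp R => mass_sum2 x).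
Proof.
apply: (@ge0_emeasurable_sum _ _ _ _ (fun i x => (x i ^+ 2)%:E) xpredT) =>
  [k x _ _|k _].
  by rewrite lee_fin sqr_ge0.
by apply/measurable_EFinP; apply: measurable_funX; exact: measurable_mass.
Qed.

Lemma mass_sum_ge0 x : (0 <= mass_sum x)%E.
Proof. by apply: nneseries_ge0 => k _ _; rewrite lee_fin mass_ge0. Qed.

Lemma mass_sum_fin x : mass_sum x = (fine (mass_sum x))%:E.
Proof.
rewrite fineK // ge0_fin_numE ?mass_sum_ge0 //.
by apply: le_lt_trans (mass_le1 x) _; rewrite ltry.
Qed.

Lemma mass_le_one x k : x k <= 1.
Proof.
rewrite -lee_fin; apply: le_trans (mass_le1 x).
rewrite (@nneseriesD1 _ (fun i => (x i)%:E) k xpredT) // => [|i _].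
  by rewrite leeDl //; apply: nneseries_ge0 => i _ _; rewrite lee_fin mass_ge0.
by rewrite lee_fin mass_ge0.
Qed.

(** The point masses of the law of the [i]-th colour. *)
Definition colour_law x (i : nat) (z : int) : R :=
  match z with
  | Posz 0 => 0
  | Posz k.+1 => x k
  | Negz k => if k == i then 1 - fine (mass_sum x) else 0
  end.

Lemma measurable_colour_law i z :
  measurable_fun setT (fun x => colour_law x i z).
Proof.
case: z => [[|k]|k] /=; first exact: measurable_cst.
  exact: measurable_mass.
case: eqP => _; last exact: measurable_cst.
apply: measurable_funB; first exact: measurable_cst.
apply: measurableT_comp; first exact: fine_measurable.
exact: measurable_mass_sum.
Qed.

End mass_functions.

Section paintbox.
Variables (R : realType) (x : massp R).
Context d (Omega : measurableType d) (Pr : probability Omega R).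
Variable X : nat -> Omega -> int.
Hypothesis mX : forall i (A : set int), measurable (X i @^-1` A).
Hypothesis indX : independent_int Pr X.
Hypothesis massX : forall i k, Pr (X i @^-1` [set (k.+1)%:Z]) = (x k)%:E.
Hypothesis dustX : forall i,
  Pr (X i @^-1` [set (- (i.+1)%:Z)%R]) = (1 - mass_sum x)%E.

Local Notation colours w := (part_comap (X ^~ w) part0).

(** The listed colours already exhaust the total mass, so every other integer has
    probability 0. *)
Lemma colour_lawE i z : Pr (X i @^-1` [set z]) = (colour_law x i z)%:E.
Proof.
pose G : set int := [set z | exists k, z = (k.+1)%:Z] `|` [set (- (i.+1)%:Z)%R].
have G1 : Pr (X i @^-1` G) = 1%E.
  have split_G : Pr (X i @^-1` G) =
      (Pr (\bigcup_k X i @^-1` [set k.+1%:Z]) +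
       Pr (X i @^-1` [set (- (i.+1)%:Z)%R]))%E.
    rewrite -measureU; first 1 last.
    - by apply: bigcup_measurable => k _; exact: mX.
    - exact: mX.
    - by apply/seteqP; split=> // w [/= [k _ /= ->]].
    by congr (Pr _); apply/seteqP; split=> w /=;
      [case=> [[k ?]|]; [left; exists k|right]|
       case=> [[k _ ?]|]; [left; exists k|right]].
  rewrite split_G measure_disjoint_union => [|k|k l w /= -> [->]//]; last exact: mX.
  rewrite (eq_eseriesr (fun k _ => massX i k)) dustX -/(mass_sum x).
  by rewrite mass_sum_fin -EFinB -EFinD subrKC.
have out z' : ~ G z' -> Pr (X i @^-1` [set z']) = 0%E.
  move=> Gz; apply/eqP; rewrite -measure_le0.
  apply: (@le_trans _ _ (Pr (~` (X i @^-1` G)))).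
    apply: (measure_mono Pr) => //; first exact: measurableC.
    by move=> w /= -> .
  by rewrite probability_setC // G1 subee.
case: z => [[|k]|k] /=.
- by apply: out => -[[k]|] //.
- exact: massX.
- case: eqP => [->|ki]; first by rewrite NegzE dustX mass_sum_fin.
  apply: out; rewrite NegzE => -[[l] //|/= /oppr_inj [] /ki //].
Qed.

Lemma joint_law m (A : nat -> set int) :
  Pr (\bigcap_(i in `I_m) X i @^-1` A i) = (\prod_(i < m) Pr (X i @^-1` A i))%E.
Proof.
pose J := [fset i in iota 0 m]%fset.
have -> : `I_m = [set` J].
  by apply/seteqP; split=> i /=; rewrite !inE mem_iota.
rewrite indX -(big_mkord xpredT (fun i => Pr (X i @^-1` A i))) /index_iota subn0.
apply: perm_big; apply: uniq_perm; rewrite ?fset_uniq ?iota_uniq // => i.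
by rewrite !inE.
Qed.

Lemma paintbox_sim01 : (mass_sum2 x <= Pr [set w | colours w 0%N 1%N])%E.
Proof.
pose F k : set Omega := X 0%N @^-1` [set k.+1%:Z] `&` X 1%N @^-1` [set k.+1%:Z].
have mF k : measurable (F k) by apply: measurableI; exact: mX.
have PF k : Pr (F k) = (x k ^+ 2)%:E.
  rewrite -(_ : \bigcap_(i in `I_2) X i @^-1` [set k.+1%:Z] = F k).
    by rewrite (joint_law _ (fun=> [set k.+1%:Z])) !big_ord_recl big_ord0 mule1
      !massX -EFinM.
  apply/seteqP; split=> [w H|w [H0 H1] [|[|//]] //].
  by split; apply: H.
rewrite /mass_sum2 -(eq_eseriesr (fun k _ => PF k)).
rewrite -(measure_disjoint_union Pr) //.
  apply: (measure_mono Pr); first exact: bigcup_measurable.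
  - rewrite (_ : [set w | _] =
      \bigcup_(z in [set: int]) (X 0%N @^-1` [set z] `&` X 1%N @^-1` [set z])).
      apply: countable_bigcupT_measurable => // z; apply: measurableI; exact: mX.
    by apply/seteqP; split=> [w /= E|w [z _ [/= -> ->]]//]; exists (X 0%N w).
  - by move=> w [k _ [/= e0 e1]]; rewrite /= e0 e1.
by move=> k l w [/= e _] [/=]; rewrite e => -[].
Qed.

(** Point 0 has a colour of positive mass with probability [mass_sum x], and by
    independence another point almost surely receives that same colour. *)
Lemma paintbox_meets :
  (mass_sum x <= Pr [set w | exists j, colours w 0%N j.+1])%E.
Proof.
have mE : measurable [set w | exists j, colours w 0%N j.+1].
  rewrite (_ : [set w | _] = \bigcup_j \bigcup_(z in [set: int])
      (X 0%N @^-1` [set z] `&` X j.+1 @^-1` [set z])).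
    apply: bigcup_measurable => j _.
    by apply: countable_bigcupT_measurable => // z; apply: measurableI; exact: mX.
  apply/seteqP; split=> [w /= [j E]|w [j _ [z _ [/= z0 zj]]]].
    by exists j => //; exists (X 0%N w).
  by exists j; rewrite /= z0 zj.
pose E k : set Omega := X 0%N @^-1` [set k.+1%:Z] `&`
  [set w | exists j, colours w 0%N j.+1].
have mEk k : measurable (E k) by apply: measurableI => //; exact: mX.
have xE k : ((x k)%:E <= Pr (E k))%E.
  (* none of the points 1, ..., J repeats the colour of point 0 *)
  pose N J : set Omega := \bigcap_(i in `I_J.+1)
    X i @^-1` (if i == 0%N then [set k.+1%:Z] else ~` [set k.+1%:Z]).
  have mN J : measurable (N J).
    by apply: bigcap_measurable => [|i _]; [exists 0%N|exact: mX].
  have PN J : Pr (N J) = (x k * (1 - x k) ^+ J)%:E.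
    rewrite (joint_law _
      (fun i => if i == 0%N then [set k.+1%:Z] else ~` [set k.+1%:Z])).
    rewrite big_ord_recl /= massX EFinM; congr (_ * _)%E.
    rewrite (eq_bigr (fun=> (1 - x k)%:E)).
      by rewrite prodEFin prodr_const card_ord.
    by move=> i _; rewrite -preimage_setC probability_setC ?massX //; exact: mX.
  have cover J : ((x k)%:E <= Pr (E k) + (x k * (1 - x k) ^+ J)%:E)%E.
    rewrite -PN -(massX 0%N k).
    apply: le_trans (_ : Pr (E k `|` N J) <= _)%E.
      apply: (measure_mono Pr); [exact: mX|exact: measurableU|].
      move=> w /= wk; have [H|H] := pselect (exists j, colours w 0%N j.+1).
        by left.
      right=> -[|j] //= _ wj; apply: H; exists j => /=.
      by rewrite wk wj.
    exact: measureU2.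
  have Efin : Pr (E k) \is a fin_num by exact: fin_num_measure.
  rewrite -(fineK Efin) lee_fin.
  have lim : (fun J => fine (Pr (E k)) + x k * (1 - x k) ^+ J) @ \oo -->
      fine (Pr (E k)).
    have := mass_ge0 x k; rewrite le_eqVlt => /predU1P[<-|x0].
      under eq_fun do rewrite mul0r addr0.
      exact: cvg_cst.
    rewrite -[X in _ --> X]addr0; apply: cvgD; first exact: cvg_cst.
    rewrite -[X in _ --> X](mulr0 (x k)); apply: cvgMr; apply: cvg_expr.
    by rewrite ger0_norm ?subr_ge0 ?mass_le_one // ltrBlDr ltrDl.
  rewrite -(cvg_lim _ lim) //; apply: limr_ge.
    by apply/cvg_ex; eexists; exact: lim.
  by apply: nearW => J; rewrite -lee_fin EFinD fineK.
rewrite /mass_sum; apply: (@le_trans _ _ (\sum_(0 <= k <oo) Pr (E k))%E).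
  by apply: lee_nneseries => // k _; rewrite lee_fin mass_ge0.
rewrite -(measure_disjoint_union Pr) //; last first.
  by move=> k l w [/= e _] [/=]; rewrite e => -[].
apply: (measure_mono Pr) => //; first exact: bigcup_measurable.
by move=> w [k _ []].
Qed.

(** The contribution of the [k]-th colouring of the first [m] points, in an
    enumeration of all of them, to the probability that the colour classes form
    a partition in [D]. *)
Definition colouring_term (x' : massp R) m (D : set (part 'I_m)) (k : nat) : R :=
  if pickle_inv k is Some y then
    if `[< D (part_comap (y : {ffun 'I_m -> int}) part0) >]
    then \prod_(i < m) colour_law x' i (y i) else 0
  else 0.

Lemma paintbox_cylinder m (D : set (part 'I_m)) :
  Pr [set w | D (restr m (colours w))] =
  (\sum_(0 <= k <oo) (colouring_term x D k)%:E)%E.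
Proof.
pose Y w : {ffun 'I_m -> int} := [ffun i : 'I_m => X i w].
have YE w : restr m (colours w) = part_comap (Y w) part0.
  by apply: part_eqP => i j; rewrite /= !ffunE.
have Yy (y : {ffun 'I_m -> int}) : measurable [set w | Y w = y] /\
    Pr [set w | Y w = y] = (\prod_(i < m) colour_law x i (y i))%:E.
  pose A i : set int := if insub i is Some i' then [set y i'] else setT.
  have -> : [set w | Y w = y] = \bigcap_(i in `I_m) X i @^-1` A i.
    apply/seteqP; split=> [w /= Yw i im|w H].
      by rewrite /A insubT /= -Yw ffunE.
    apply/ffunP => i; rewrite ffunE.
    by have := H i (ltn_ord i); rewrite /A valK.
  split; first by apply: bigcap_measurableType => i _; exact: mX.
  rewrite joint_law -prodEFin; apply: eq_bigr => i _.
  by rewrite /A valK colour_lawE.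
pose F k := [set w | choice.pickle (Y w) = k /\ D (part_comap (Y w) part0)].
have FE k : measurable (F k) /\ Pr (F k) = (colouring_term x D k)%:E.
  have F0 : (forall w, ~ F k w) -> measurable (F k) /\ Pr (F k) = 0%E.
    move=> H; have -> : F k = set0 by apply/seteqP; split=> // w /H.
    by rewrite measure0; split.
  rewrite /colouring_term.
  case E : pickle_inv => [y|]; last first.
    by apply: F0 => w [Yk _]; move: E; rewrite -Yk pickleK_inv.
  have yk : choice.pickle y = k.
    by have := @pickle_invK {ffun 'I_m -> int} k; rewrite E.
  case: asboolP => [Dy|nDy]; last first.
    apply: F0 => w [Yk DY]; apply: nDy; suff <- : Y w = y by [].
    by apply: (pcan_inj choice.pickleK); rewrite Yk yk.
  have -> : F k = [set w | Y w = y]; last exact: Yy.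
  apply/seteqP; split=> [w [Yk _]|w /= Ywy]; last by rewrite /F /= Ywy.
  by apply: (pcan_inj choice.pickleK); rewrite Yk yk.
rewrite (_ : [set w | _] = \bigcup_k F k); last first.
  apply/seteqP; split=> [w /=|w [k _ [_]] /=]; rewrite YE // => Dw.
  by exists (choice.pickle (Y w)).
rewrite measure_disjoint_union => [|k|k l w [<- _] [<- _]//].
  by apply: eq_eseriesr => k _; exact: (FE k).2.
exact: (FE k).1.
Qed.

End paintbox.

Section paintbox_family.
Variables (R : realType) (mu : massp R -> probability (part nat) R).
Hypothesis muP : forall x, is_paintbox_law x (mu x).
Local Open Scope ereal_scope.

Lemma colour_law_ge0 (x : massp R) i z : (0 <= colour_law x i z)%R.
Proof.
case: z => [[|k]|k] //=; first exact: mass_ge0.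
by case: eqP => // _; rewrite subr_ge0 -lee_fin -mass_sum_fin mass_le1.
Qed.

(** Cylinder probabilities are countable sums of products of the masses, hence
    measurable in them; this is what makes the mixtures of paintbox laws additive
    and continuous along increasing events. *)
Lemma measurable_paintbox m (D : set (part 'I_m)) :
  measurable_fun setT (fun x => mu x (restr m @^-1` D)).
Proof.
rewrite (_ : (fun x => _) = fun x =>
    \sum_(0 <= k <oo) (colouring_term x D k)%:E); last first.
  apply/funext => x; have [d [Om [Pr [X [mX iX X1 X2 ->]]]]] := muP x.
    exact: paintbox_cylinder.
  exact: measurable_cyl.
apply: (@ge0_emeasurable_sum _ _ _ _
  (fun k x => (colouring_term x D k)%:E) xpredT) => [k x _ _|k _].
  rewrite lee_fin /colouring_term.
  case: (@pickle_inv {ffun 'I_m -> int} k) => // y; case: ifP => // _.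
  by apply: prodr_ge0 => i _; exact: colour_law_ge0.
apply/measurable_EFinP; rewrite /colouring_term.
case: (@pickle_inv {ffun 'I_m -> int} k) => [y|]; last exact: measurable_cst.
case: (asboolP (D (part_comap y part0))) => _; last exact: measurable_cst.
by apply: measurable_prod => i _; exact: measurable_colour_law.
Qed.

Lemma paintbox_sim01_ge x : mass_sum2 x <= mu x [set r | r 0%N 1%N].
Proof.
have [d [Om [Pr [X [mX iX X1 X2 ->]]]]] := muP x; last exact: measurable_sim.
exact: paintbox_sim01.
Qed.

Lemma paintbox_meets_ge x : mass_sum x <= mu x [set r | exists j, r 0%N j.+1].
Proof.
have [d [Om [Pr [X [mX iX X1 X2 ->]]]]] := muP x.
  exact: paintbox_meets.
rewrite [X in measurable X](_ : _ = \bigcup_j [set r : part nat | r 0%N j.+1]).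
  by apply: bigcup_measurable => j _; exact: measurable_sim.
by apply/seteqP; split=> r [j]; exists j.
Qed.

End paintbox_family.

(** * Finite Markov chains in continuous time *)

Lemma cvg_sum_fin (R : realType) (I : Type) (s : seq I) (A : pred I) (T : Type)
    (F : set_system T) (f : I -> T -> R) (l : I -> R) : Filter F ->
  (forall i, A i -> f i @ F --> l i) ->
  \sum_(i <- s | A i) f i x @[x --> F] --> \sum_(i <- s | A i) l i.
Proof. by move=> FF fl; apply: cvg_big => //; exact: add_continuous. Qed.

Section contraction.
Variables (R : realType) (S : finType) (Q : S -> S -> R) (s : S) (e : R).
Hypothesis Q_ge0 : forall a b, 0 <= Q a b.
Hypothesis Q_sum1 : forall a, \sum_b Q a b = 1.
Hypothesis Q_ge : forall a, e <= Q a s.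

(** Doeblin's argument: on measures of total mass zero, the part of the kernel
    that jumps to [s] whatever the starting point acts as zero, and the rest of
    the kernel has mass [1 - e]. *)
Lemma doeblin_contraction (v : S -> R) : \sum_a v a = 0 ->
  \sum_b `|\sum_a v a * Q a b| <= (1 - e) * \sum_a `|v a|.
Proof.
move=> v0; pose Q' a b := Q a b - e * (b == s)%:R.
have Q'_ge0 a b : 0 <= Q' a b.
  rewrite /Q'; case: eqP => [->|_]; first by rewrite mulr1 subr_ge0.
  by rewrite mulr0 subr0.
have Q'_sum a : \sum_b Q' a b = 1 - e.
  rewrite /Q' sumrB Q_sum1 -mulr_sumr (bigD1 s) //= eqxx big1 ?addr0 ?mulr1 //.
  by move=> b /negPf ->.
have -> : \sum_b `|\sum_a v a * Q a b| = \sum_b `|\sum_a v a * Q' a b|.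
  apply: eq_bigr => b _; congr Num.norm.
  rewrite /Q' [RHS](eq_bigr (fun a => v a * Q a b - v a * (e * (b == s)%:R))).
    by rewrite sumrB -mulr_suml v0 mul0r subr0.
  by move=> a _; rewrite mulrBr.
apply: (@le_trans _ _ (\sum_b \sum_a `|v a| * Q' a b)).
  apply: ler_sum => b _; apply: le_trans (ler_norm_sum _ _ _) _.
  by apply: ler_sum => a _; rewrite normrM (ger0_norm (Q'_ge0 _ _)).
rewrite exchange_big mulr_sumr; apply: ler_sum => a _.
by rewrite -mulr_sumr Q'_sum mulrC.
Qed.

Lemma doeblin_cvg (r : S -> R) (u : nat -> S -> R) :
  0 < e ->
  \sum_a r a = 1 -> (forall b, \sum_a r a * Q a b = r b) ->
  (forall k, \sum_a u k a = 1) ->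
  (forall k b, u k.+1 b = \sum_a u k a * Q a b) ->
  forall b, (fun k => u k b) @ \oo --> r b.
Proof.
move=> e0 r1 rQ u1 uQ b.
pose C := \sum_a `|u 0%N a - r a|.
have bnd k : \sum_a `|u k a - r a| <= (1 - e) ^+ k * C.
  elim: k => [|k IH]; first by rewrite expr0 mul1r.
  have -> : \sum_a `|u k.+1 a - r a| = \sum_c `|\sum_a (u k a - r a) * Q a c|.
    apply: eq_bigr => c _; congr Num.norm; rewrite uQ -(rQ c) -sumrB.
    by apply: eq_bigr => a _; rewrite mulrBl.
  apply: (le_trans (doeblin_contraction _)).
    by rewrite sumrB u1 r1 subrr.
  rewrite exprS -mulrA; apply: ler_wpM2l => //.
  rewrite subr_ge0 (le_trans (Q_ge s)) // -(Q_sum1 s) (bigD1 s) //=.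
  by rewrite lerDl; apply: sumr_ge0.
apply/cvgrPdist_le => eps eps0.
have e1 : `|1 - e| < 1.
  have : e <= 1.
    rewrite (le_trans (Q_ge s)) // -(Q_sum1 s) (bigD1 s) //=.
    by rewrite lerDl; apply: sumr_ge0.
  by move=> le1; rewrite ger0_norm ?subr_ge0 // ltrBlDr ltrDl.
have : (fun k => (1 - e) ^+ k * C) @ \oo --> 0 * C.
  by apply: cvgMl; exact: cvg_expr.
rewrite mul0r => /cvgrPdist_le /(_ eps eps0) [N _ HN]; exists N => // k /= Nk.
rewrite distrC; apply: le_trans (_ : \sum_a `|u k a - r a| <= _).
  by rewrite (bigD1 b) //= lerDl; apply: sumr_ge0.
apply: le_trans (bnd k) _.
have := HN k Nk; rewrite sub0r normrN; apply: le_trans; exact: ler_norm.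
Qed.

End contraction.

Section chain.
Variables (R : realType) (S : finType) (P : R -> S -> S -> R) (q : S -> S -> R).
Hypothesis P_ge0 : forall t a b, 0 <= P t a b.
Hypothesis P_sum1 : forall t a, \sum_b P t a b = 1.
Hypothesis P_CK : forall s t a b, 0 <= s -> 0 <= t ->
  P (s + t) a b = \sum_c P s a c * P t c b.
Hypothesis P_rate : forall a b, a <> b -> P h a b / h @[h --> 0^'+] --> q a b.

Lemma rate_ge0 a b : a <> b -> 0 <= q a b.
Proof.
move=> ab; rewrite -(cvg_lim _ (P_rate ab)) //; apply: limr_ge.
  by apply/cvg_ex; eexists; exact: P_rate ab.
by near=> h; rewrite divr_ge0.
Unshelve. all: by end_near. Qed.

(** In equilibrium as much mass leaves a set of states as enters it. Before
    division by [h] and passage to the limit this is stationarity summed over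
    the set. *)
Lemma stationary_balance (r : S -> R) (D : pred S) :
  (forall t b, 0 <= t -> \sum_a r a * P t a b = r b) ->
  \sum_(a | D a) \sum_(b | ~~ D b) r a * q a b =
  \sum_(a | ~~ D a) \sum_(b | D b) r a * q a b.
Proof.
move=> rP.
have lim (A B : pred S) : (forall a, A a -> B a -> False) ->
    \sum_(a | A a) \sum_(b | B b) r a * (P h a b / h) @[h --> 0^'+] -->
    \sum_(a | A a) \sum_(b | B b) r a * q a b.
  move=> AB; apply: (@cvg_sum_fin R) => a Aa; apply: cvg_sum_fin => b Bb.
  by apply: cvgMr; apply: P_rate => E; apply: (AB a) => //; rewrite E.
apply: (cvg_unique _ (lim D (predC D) _)) => //.
  by move=> a /= Da /negP.
have L := lim (predC D) D (fun a nDa Da => negP nDa Da).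
apply: cvg_trans L.
apply: near_eq_cvg; near=> h.
have h0 : 0 <= h by [].
pose f (A B : pred S) := \sum_(a | A a) \sum_(b | B b) r a * P h a b.
have scale (A B : pred S) : \sum_(a | A a) \sum_(b | B b) r a * (P h a b / h) =
    f A B / h.
  rewrite /f mulr_suml; apply: eq_bigr => a _; rewrite mulr_suml.
  by apply: eq_bigr => b _; rewrite mulrA.
rewrite !scale; congr (_ / _).
have E1 : f D D + f (predC D) D = \sum_(b | D b) r b.
  rewrite /f exchange_big [X in _ + X]exchange_big -big_split /=.
  by apply: eq_bigr => b _; rewrite -(rP h b h0) [RHS](bigID D).
have E2 : f D D + f D (predC D) = \sum_(b | D b) r b.
  rewrite /f -big_split /=; apply: eq_bigr => a _.
  transitivity (\sum_b r a * P h a b); first by rewrite [RHS](bigID D).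
  by rewrite -mulr_sumr P_sum1 mulr1.
by apply: (addrI (f D D)); rewrite E1 E2.
Unshelve. all: by end_near. Qed.

Lemma trans_cvg0 a b : a <> b -> P h a b @[h --> 0^'+] --> 0.
Proof.
move=> ab.
have : (P h a b / h) * h @[h --> 0^'+] --> q a b * 0.
  apply: cvgM; first exact: P_rate.
  by apply: cvg_at_right_filter; exact: cvg_id.
rewrite mulr0; apply: cvg_trans; apply: near_eq_cvg; near=> h.
by rewrite divfK // gt_eqF.
Unshelve. all: by end_near. Qed.

Lemma trans_ge s t a b c : 0 <= s -> 0 <= t ->
  P s a b * P t b c <= P (s + t) a c.
Proof.
move=> s0 t0; rewrite P_CK // (bigD1 b) //= lerDl.
by apply: sumr_ge0 => d _; rewrite mulr_ge0.
Qed.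

Lemma trans_stay a : \forall h \near 0^'+, 0 < P h a a.
Proof.
have : 1 - \sum_(b | b != a) P h a b @[h --> 0^'+] --> 1 - \sum_(b | b != a) (0 : R).
  apply: cvgB; first exact: cvg_cst.
  by apply: (@cvg_sum_fin R) => b /eqP ba; apply: trans_cvg0 => /esym.
rewrite big1 // subr0 => /cvgrPdist_lt /(_ _ ltr01); apply: filterS => h.
have -> : 1 - \sum_(b | b != a) P h a b = P h a a.
  by rewrite -(P_sum1 h a) (bigD1 a) //= addrK.
by rewrite ltr_norml => /andP[_]; rewrite ltrBlDr ltrDl.
Qed.

Lemma trans_diag_gt0 a t : 0 < t -> 0 < P t a a.
Proof.
move=> t0; have [e /= e0 He] := trans_stay a.
have [N tN] : exists N : nat, t / N.+1%:R < e.
  exists (Num.truncn (t / e)); rewrite ltr_pdivrMr // mulrC -ltr_pdivrMr //.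
  exact: truncnS_gt.
have sN : 0 < t / N.+1%:R by rewrite divr_gt0.
have Ps : 0 < P (t / N.+1%:R) a a.
  by apply: He => //=; rewrite sub0r normrN gtr0_norm.
have -> : t = (t / N.+1%:R) *+ N.+1 by rewrite -mulr_natr divfK // pnatr_eq0.
elim: N {tN} (t / _) sN Ps => [|N IH] s s0 Ps //.
rewrite mulrS; apply: lt_le_trans (@trans_ge _ _ _ a _ _ _); rewrite ?ltW //.
  by rewrite mulr_gt0 // IH.
by rewrite mulrn_wgt0.
Qed.

Definition leads a b := exists2 t, 0 < t & 0 < P t a b.

Lemma leads_refl a : leads a a.
Proof. by exists 1 => //; exact: trans_diag_gt0. Qed.

Lemma leads_trans a b c : leads a b -> leads b c -> leads a c.
Proof.
move=> [s s0 Ps] [t t0 Pt]; exists (s + t); first by rewrite addr_gt0.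
by apply: lt_le_trans (@trans_ge _ _ _ b _ _ _); rewrite ?ltW // mulr_gt0.
Qed.

Lemma rate_leads a b : a <> b -> 0 < q a b -> leads a b.
Proof.
move=> ab q0; have := P_rate ab => /cvgrPdist_lt /(_ _ q0) H.
have : \forall h \near 0^'+, 0 < h /\ 0 < P h a b.
  near=> h; have h0 : 0 < h by [].
  split=> //; have : `|q a b - P h a b / h| < q a b by near: h.
  have := P_ge0 h a b; rewrite le_eqVlt => /predU1P[<-|//].
  by rewrite mul0r subr0 gtr0_norm // ltxx.
by move=> /filter_ex [h [h0 Ph]]; exists h.
Unshelve. all: by end_near. Qed.

(** A state that every state leads to is reached from all of them at one common
    time, because the chain can wait there for as long as needed. *)
Lemma leads_common_time s : (forall a, leads a s) ->
  exists T e : R, [/\ 0 < T, 0 < e & forall a, e <= P T a s].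
Proof.
move=> H; have {H} /choice[t Ht] : forall a, exists t, 0 < t /\ 0 < P t a s.
  by move=> a; have [t t0 Pt] := H a; exists t.
pose T := 1 + \sum_a t a.
have tT a : 0 < T - t a.
  rewrite /T (bigD1 a) //= addrCA addrAC subrr add0r ltr_wpDr //.
  by apply: sumr_ge0 => b _; rewrite ltW // (Ht b).1.
have PT a : 0 < P T a s.
  rewrite -(subrKC (t a) T); apply: lt_le_trans (@trans_ge _ _ _ s _ _ _).
  - by rewrite mulr_gt0 ?(Ht a).2 // trans_diag_gt0.
  - by rewrite ltW // (Ht a).1.
  - by rewrite ltW.
have P1 a : P T a s <= 1.
  by rewrite -(P_sum1 T a) (bigD1 s) //= lerDl sumr_ge0.
exists T, (\prod_a P T a s); split.
- by rewrite /T ltr_wpDr // sumr_ge0 // => a _; rewrite ltW // (Ht a).1.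
- exact: prodr_gt0.
- move=> a; rewrite (bigD1 a) //= ler_piMr // prodr_ile1 // => b _.
  by rewrite P_ge0 P1.
Qed.

End chain.

(** * Coagulation and fragmentation rates *)

(** Points are designated by their values because these notions are used on the
    set of block labels, whose cardinal is not syntactically a successor. *)
Definition zero_meets m (a : part 'I_m) : bool :=
  `[< exists i j : 'I_m, [/\ nat_of_ord i = 0%N, nat_of_ord j <> 0%N & a i j] >].

Definition zero_avoids_one m (a : part 'I_m) : bool :=
  `[< forall i j : 'I_m, nat_of_ord i = 0%N -> nat_of_ord j = 1%N -> ~ a i j >].

Lemma zero_meetsP m (r : part nat) :
  zero_meets (restr m r) <-> exists2 j, (j.+1 < m)%N & r 0%N j.+1.
Proof.
split=> [/asboolP[i [[[|j] jm] [/= i0 // _ rij]]]|[j jm r0j]].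
  by exists j => //; rewrite -i0.
have m0 : (0 < m)%N by apply: ltn_trans jm.
by apply/asboolP; exists (Ordinal m0), (Ordinal jm).
Qed.

Section rates.
Variables (R : realType) (mu : massp R -> probability (part nat) R).
Hypothesis muP : forall x, is_paintbox_law x (mu x).
Local Open Scope ereal_scope.

Lemma mixture_fin_split (nu : {measure set (massp R) -> \bar R}) m
    (D : pred (part 'I_m)) :
  \sum_(a | D a) \int[nu]_x mu x (restr m @^-1` [set a]) =
  \int[nu]_x mu x (restr m @^-1` [set a | D a]).
Proof.
rewrite -big_filter -ge0_integral_sum //; last first.
  by move=> a; exact: measurable_paintbox.
apply: eq_integral => x _; rewrite big_filter.
by rewrite -measure_fin_split // => a; exact: measurable_cyl.
Qed.

Lemma dirac_fin_split (r : part nat) m (D : pred (part 'I_m)) :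
  \sum_(a | D a) \d_r (restr m @^-1` [set a]) =
  \d_r (restr m @^-1` [set a | D a]) :> \bar R.
Proof.
by rewrite -(measure_fin_split \d_r) // => a; exact: measurable_cyl.
Qed.

Lemma coag_measure_fin_split ck (nu : {measure set (massp R) -> \bar R}) m
    (D : pred (part 'I_m)) :
  \sum_(a | D a) coag_measure mu ck nu (restr m @^-1` [set a]) =
  coag_measure mu ck nu (restr m @^-1` [set a | D a]).
Proof.
rewrite /coag_measure big_split /= mixture_fin_split; congr (_ + _).
rewrite -ge0_sume_distrr => [|a _]; last by apply: esum_ge0.
congr (_ * _); rewrite /kingman -esum_sum //.
by apply: eq_esum => ij _; exact: dirac_fin_split.
Qed.

Lemma frag_measure_fin_split ce (nu : {measure set (massp R) -> \bar R}) m
    (D : pred (part 'I_m)) :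
  \sum_(a | D a) frag_measure mu ce nu (restr m @^-1` [set a]) =
  frag_measure mu ce nu (restr m @^-1` [set a | D a]).
Proof.
rewrite /frag_measure big_split /= mixture_fin_split; congr (_ + _).
rewrite -ge0_sume_distrr => [|a _]; last exact: nneseries_ge0.
congr (_ * _); rewrite /erosion -nneseries_sum //.
by apply: eq_eseriesr => n _; exact: dirac_fin_split.
Qed.

Section coagulation.
Variables (ck : R) (nuC : {measure set (massp R) -> \bar R}).
Hypothesis ck_ge0 : (0 <= ck)%R.

(** Since block 0 is the block of point 0, this is the intensity with which the
    block of point 0 is merged with another one when there are [m] blocks. *)
Definition joining_rate m :=
  coag_measure mu ck nuC (restr m @^-1` [set a | zero_meets a]).

Lemma zero_meets_mono m n : (m <= n)%N ->
  restr m @^-1` [set a | zero_meets a] `<=` restr n @^-1` [set a | zero_meets a].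
Proof.
move=> mn r /zero_meetsP[j jm rj]; apply/zero_meetsP; exists j => //.
exact: leq_trans jm mn.
Qed.

Lemma kingman_ge0 A : 0 <= kingman R A.
Proof. exact: esum_ge0. Qed.

Lemma coag_measure_ge0 A : 0 <= coag_measure mu ck nuC A.
Proof.
rewrite adde_ge0 ?mule_ge0 ?lee_fin ?kingman_ge0 //.
by apply: integral_ge0 => x _; exact: measure_ge0.
Qed.

Lemma joining_rate_mono m n : (m <= n)%N -> joining_rate m <= joining_rate n.
Proof.
move=> mn; apply: leeD.
  apply: lee_wpmul2l; first by rewrite lee_fin.
  apply: le_esum => ij _; apply: measure_mono; [exact: measurable_cyl..|].
  exact: zero_meets_mono.
apply: ge0_le_integral => //; [exact: measurable_paintbox..|].
move=> x _; apply: measure_mono; [exact: measurable_cyl..|].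
exact: zero_meets_mono.
Qed.

Lemma kingman_zero_meets m :
  (m%:R)%:E <= kingman R (restr m.+1 @^-1` [set a | zero_meets a]).
Proof.
apply: esum_ge; exists [set` [seq (0%N, j.+1) | j <- iota 0 m]].
  by split; [exact: finite_seq|move=> ij /= /mapP[j _ ->]].
rewrite -fsbig_seq; last by rewrite map_inj_uniq ?iota_uniq // => j k [].
rewrite big_map big_seq (eq_bigr (fun=> 1)).
  by rewrite -big_seq big_const_seq count_predT size_iota iter_addr_0 EFin_natmul.
move=> j; rewrite mem_iota add0n => jm; rewrite diracE mem_set //.
by apply/zero_meetsP; exists j; rewrite //= eqxx.
Qed.

Hypothesis quick : \int[nuC]_x mass_sum x = +oo \/ (0 < ck)%R.

(** The event that point 0 is joined by another of the first [m] points increases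
    with [m] to the event that it is joined at all, whose intensity is infinite
    exactly under quick coalescence. *)
Lemma joining_rate_unbounded (M : R) : exists m, M%:E <= joining_rate m.
Proof.
apply: contrapT => H.
have {}H m : joining_rate m <= M%:E.
  by rewrite leNgt; apply/negP => lt; apply: H; exists m; exact: ltW.
case: quick => [foo|ck0]; last first.
  have := H (Num.truncn (M / ck)).+2.
  apply/negP; rewrite -ltNge.
  apply: (@lt_le_trans _ _ (ck * (Num.truncn (M / ck)).+1%:R)%:E).
    by rewrite lte_fin mulrC -ltr_pdivrMr // truncnS_gt.
  rewrite EFinM; apply: le_trans (_ : ck%:E * kingman R _ <= _).
    by apply: lee_wpmul2l; [rewrite lee_fin|exact: kingman_zero_meets].
  by rewrite leeDl //; apply: integral_ge0 => x _; exact: measure_ge0.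
pose g m x := mu x (restr m @^-1` [set a | zero_meets a]).
have mg m : measurable_fun setT (g m) by exact: measurable_paintbox.
have g0 m x : setT x -> 0 <= g m x by move=> _; exact: measure_ge0.
have gmono x : setT x -> {homo g ^~ x : m n / (m <= n)%N >-> m <= n}.
  move=> _ m n mn; apply: measure_mono; [exact: measurable_cyl..|].
  exact: zero_meets_mono.
have glim x : g ^~ x @ \oo -->
    mu x (\bigcup_m (restr m @^-1` [set a | zero_meets a])).
  apply: (nondecreasing_cvg_mu (mu := mu x)) => [m||m n mn].
  - exact: measurable_cyl.
  - by apply: bigcup_measurable => m _; exact: measurable_cyl.
  - by apply/subsetPset; exact: zero_meets_mono.
have mlim : measurable_fun setT (fun x => limn (g ^~ x)).
  apply: (emeasurable_fun_cvg g) => // x _.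
  by have := glim x => /[dup] /cvg_lim -> //.
suff : \int[nuC]_x mass_sum x <= M%:E by rewrite foo.
apply: (@le_trans _ _ (\int[nuC]_x (limn (g ^~ x)))).
  apply: ge0_le_integral => //.
  - by move=> x _; exact: mass_sum_ge0.
  - exact: measurable_mass_sum.
  move=> x _; rewrite (cvg_lim _ (glim x)) //.
  apply: (le_trans (paintbox_meets_ge muP x)).
  rewrite [X in mu x X <= _](_ : _ =
    \bigcup_m (restr m @^-1` [set a | zero_meets a])) //.
  apply/seteqP; split=> [r [j rj]|r [m _ /zero_meetsP [j _ rj]]]; last by exists j.
  by exists j.+2 => //; apply/zero_meetsP; exists j.
rewrite (monotone_convergence nuC measurableT mg g0 gmono).
apply: lime_le.
  apply: ereal_nondecreasing_is_cvgn => m n mn.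
  by apply: ge0_le_integral => // x Tx; exact: gmono.
apply: nearW => m; apply: le_trans (H m); rewrite leeDr //.
by rewrite mule_ge0 ?lee_fin ?kingman_ge0.
Qed.

(** If already the first two blocks never merged, almost every coagulation
    paintbox would have no mass at all, and coalescence would not be quick. *)
Lemma joining_rate_gt0 m : (1 < m)%N -> 0 < joining_rate m.
Proof.
move=> m1; apply: lt_le_trans (joining_rate_mono m1).
case: quick => [foo|ck0]; last first.
  apply: (@lt_le_trans _ _ (ck%:E * (1%:R)%:E)).
    by rewrite -EFinM lte_fin mulr1.
  apply: le_trans
    (_ : ck%:E * kingman R (restr 2 @^-1` [set a | zero_meets a]) <= _).
    by apply: lee_wpmul2l; [rewrite lee_fin|exact: (kingman_zero_meets 1)].
  by rewrite leeDl //; apply: integral_ge0 => x _; exact: measure_ge0.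
rewrite lt_neqAle coag_measure_ge0 andbT; apply/eqP => rate0.
have sum2_0 : \int[nuC]_x `|mass_sum2 x| = 0.
  apply/eqP; rewrite eq_le integral_ge0 // andbT rate0.
  rewrite /joining_rate /coag_measure.
  apply: (@le_trans _ _
    (\int[nuC]_x mu x (restr 2 @^-1` [set a | zero_meets a]))).
    apply: ge0_le_integral => //.
    - by apply: measurableT_comp => //; exact: measurable_mass_sum2.
    - exact: measurable_paintbox.
    move=> x _; rewrite gee0_abs; last first.
      by apply: nneseries_ge0 => k _ _; rewrite lee_fin sqr_ge0.
    apply: (le_trans (paintbox_sim01_ge muP x)).
    apply: measure_mono; [exact: measurable_sim|exact: measurable_cyl|].
    by move=> r r01; apply/zero_meetsP; exists 0%N.
  by rewrite leeDr // mule_ge0 ?lee_fin ?kingman_ge0.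
have sum2ae :=
  (ae_eq_integral_abs nuC measurableT (@measurable_mass_sum2 R)).1 sum2_0.
have : \int[nuC]_x `|mass_sum x| = 0.
  apply/ae_eq_integral_abs => //; first exact: measurable_mass_sum.
  move: sum2ae; apply: filterS => x /= H _.
  apply: eseries0 => k _ _; congr EFin; apply/eqP.
  rewrite -sqrf_eq0 eq_le sqr_ge0 andbT.
  rewrite -lee_fin.
  apply: (@le_trans _ _ (mass_sum2 x)); last by rewrite (H I).
  rewrite /mass_sum2.
  rewrite (@nneseriesD1 _ (fun i => (x i ^+ 2)%:E) k xpredT) // => [|i _].
    by rewrite leeDl //; apply: nneseries_ge0 => i _ _; rewrite lee_fin sqr_ge0.
  by rewrite lee_fin sqr_ge0.
rewrite (eq_integral (fun x => mass_sum x)) ?foo // => x _.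
by rewrite gee0_abs // mass_sum_ge0.
Qed.

End coagulation.

Section fragmentation.
Variables (ce : R) (nuD : {measure set (massp R) -> \bar R}).
Hypothesis ce_ge0 : (0 <= ce)%R.

Definition isolation_bound := ce%:E * 2%:E + \int[nuD]_x (1 - mass_sum2 x).

Lemma isolation_bound_ge0 : 0 <= isolation_bound.
Proof.
rewrite /isolation_bound adde_ge0 ?mule_ge0 ?lee_fin //.
apply: integral_ge0 => x _; rewrite sube_ge0; last by apply/orP; right.
apply: (le_trans (paintbox_sim01_ge muP x)); apply: probability_le1.
exact: measurable_sim.
Qed.

(** A point of rank 0 can only be isolated by separating it from rank 1: only
    two erosions do so, and a paintbox does so with probability at most the
    dislocated part [1 - mass_sum2 x]. *)
Lemma isolation_rate_le m : (1 < m)%N ->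
  frag_measure mu ce nuD (restr m @^-1` [set a | zero_avoids_one a]) <=
  isolation_bound.
Proof.
move=> m1; have m0 : (0 < m)%N by exact: ltnW.
have sub r : zero_avoids_one (restr m r) -> ~ r 0%N 1%N.
  by move=> /asboolP H r01; apply: (H (Ordinal m0) (Ordinal m1)).
apply: leeD.
  apply: lee_wpmul2l; first by rewrite lee_fin.
  rewrite /erosion (nneseries_split 0 2) // big_nat_recl // big_nat1.
  rewrite eseries0; last first.
    move=> [|[|k]] // _ _; rewrite diracE memNset //.
    by move=> /sub; apply.
  rewrite adde0 (_ : 2%:E = 1 + 1) // leeD // diracE lee_fin //;
  by rewrite -[leRHS]/(true%:R) ler_nat leq_b1.
apply: ge0_le_integral => //.
- exact: measurable_paintbox.
- apply: emeasurable_funB => //; exact: measurable_mass_sum2.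
move=> x _; apply: (@le_trans _ _ (mu x (~` [set r | r 0%N 1%N]))).
  apply: measure_mono => //; [exact: measurable_cyl|].
  by apply: measurableC; exact: measurable_sim.
rewrite probability_setC; last exact: measurable_sim.
by apply: leeB => //; exact: paintbox_sim01_ge.
Qed.

End fragmentation.

End rates.

(** * Flows of the restricted chains *)

Lemma frag_inj n (p : part 'I_n) k : injective (@frag n p k).
Proof.
move=> p1 p2 E.
have fragE (p' : part 'I_#|block_set p k|) a b :
    p' a b <-> frag p' (enum_val a) (enum_val b).
  split=> [pab|[_ H]].
    split=> [|_]; last by exists a, b.
    apply: block_index_ord.
    have := enum_valP a; have := enum_valP b; rewrite !inE.
    by move=> /eqP -> /eqP ->.
  by have [a' [b' [/enum_val_inj <- /enum_val_inj <-]]] := H (enum_valP a).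
by apply: part_eqP => a b; rewrite !fragE E.
Qed.

Lemma zero_meets_neq0 m (a : part 'I_m) : zero_meets a -> a <> part0.
Proof. by move=> /asboolP[i [j [i0 j0 aij]]] E; move: aij j0; rewrite E => <-. Qed.

Section flows.
Variables (R : realType) (mu : massp R -> probability (part nat) R).
Hypothesis muP : forall x, is_paintbox_law x (mu x).
Variables (ck ce : R) (nuC nuD : {measure set (massp R) -> \bar R}).
Hypothesis ck_ge0 : 0 <= ck.
Hypothesis ce_ge0 : 0 <= ce.
Variables (n : nat) (q : part 'I_n.+1 -> part 'I_n.+1 -> R).
Hypothesis q_coag : forall p (p' : part 'I_(nblocks p)), p' <> part0 ->
  (q p (coag p'))%:E = coag_measure mu ck nuC (restr (nblocks p) @^-1` [set p']).
Hypothesis q_frag : forall p k (p' : part 'I_#|block_set p k|), p' <> part1 ->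
  (q p (frag p'))%:E =
  frag_measure mu ce nuD (restr #|block_set p k| @^-1` [set p']).
Hypothesis q_other : forall p r, r <> p ->
  ~ (exists2 p' : part 'I_(nblocks p), p' <> part0 & r = coag p') ->
  ~ (exists k, exists2 p' : part 'I_#|block_set p k|, p' <> part1 & r = frag p') ->
  q p r = 0.
Hypothesis q_ge0 : forall p r, p <> r -> 0 <= q p r.

Lemma coag_zero_meets p (p' : part 'I_(nblocks p)) :
  zero_meets p' -> ~ alone (coag p') (ord0 : 'I_n.+1).
Proof.
move=> /asboolP[i [j [i0 j0 p'ij]]] /coag_alone.
have -> : block_ord p (ord0 : 'I_n.+1) = i.
  by apply: val_inj; rewrite /= block_index0 i0.
by move=> /(_ j p'ij) E; apply: j0; rewrite E.
Qed.

(** Merging block 0 with another block ends the isolation of point 0, and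
    different ways of merging lead to different states. *)
Lemma outflow_ge p : ord0 \in singles p ->
  (joining_rate mu ck nuC (nblocks p) <=
   (\sum_(r | (ord0 : 'I_n.+1) \notin singles r) q p r)%:E)%E.
Proof.
move=> /singlesP pa.
rewrite /joining_rate -coag_measure_fin_split //.
rewrite (eq_bigr (fun p' => (q p (coag p'))%:E)); last first.
  by move=> p' m0; rewrite q_coag //; exact: zero_meets_neq0.
rewrite sumEFin lee_fin.
pose A := [set p' : part 'I_(nblocks p) | zero_meets p']%SET.
have := @big_imset _ 0 +%R _ _ (@coag _ p) A (q p) (in2W (@coag_inj _ p)).
rewrite [X in _ = X](eq_bigl (@zero_meets _)); last by move=> p'; rewrite inE.
move=> <-; rewrite [leRHS](bigID (mem (@coag _ p @: A)%SET)) /=.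
rewrite (eq_bigl (fun r => ((ord0 : 'I_n.+1) \notin singles r) &&
    (r \in (@coag _ p @: A)%SET))).
  rewrite lerDl; apply: sumr_ge0 => r /andP[ra _]; apply: q_ge0 => E.
  by move/negP: ra; apply; rewrite -E; apply/singlesP.
move=> r /=; case: imsetP => [[p' ]|_]; rewrite ?andbF // andbT inE => m0 ->.
by symmetry; apply/singlesP; exact: coag_zero_meets.
Qed.

(** Coagulations never isolate a point, so only dislocations of block 0 that
    separate its two lowest points contribute. *)
Lemma inflow_le p : ord0 \notin singles p ->
  ((\sum_(r | (ord0 : 'I_n.+1) \in singles r) q p r)%:E <=
   isolation_bound ce nuD)%E.
Proof.
move=> /singlesP pa.
have bound_ge0 := isolation_bound_ge0 muP nuD ce_ge0.
pose A := [set p' : part 'I_#|block_set p 0| | zero_avoids_one p']%SET.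
have [m1|m1] := ltnP 1 #|block_set p 0|; last first.
  rewrite big1 // => r /singlesP ra.
  apply: q_other => [E|[p' p'0 E]|[k [p' p'1 E]]].
  - by apply: pa; rewrite -E.
  - apply: pa => j pj; apply: ra; rewrite E; exact: coag_coarser.
  - subst r; have [k0 + _] := frag_isolates pa ra; subst k.
    by rewrite ltnNge m1.
apply: (@le_trans _ _ (\sum_(p' in A) q p (frag p'))%:E).
  have := @big_imset _ 0 +%R _ _ (@frag _ p 0) A (q p) (in2W (@frag_inj _ p 0)).
  move=> <-; rewrite lee_fin.
  rewrite [leRHS](bigID (fun r => (ord0 : 'I_n.+1) \in singles r)) /=.
  rewrite [leLHS](bigID (mem (@frag _ p 0 @: A)%SET)) /=.
  apply: lerD.
    by rewrite le_eqVlt; apply/orP; left; apply/eqP; apply: eq_bigl => r;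
      rewrite andbC.
  rewrite [leLHS]big1 => [|r /andP[/singlesP ra /negP rA]].
    apply: sumr_ge0 => r /andP[/imsetP[p' p'A ->] _]; apply: q_ge0 => E.
    have m0 : (0 < #|block_set p 0|)%N by exact: ltnW.
    have : frag p' (enum_val (Ordinal m0)) (enum_val (Ordinal m1)).
      rewrite -E; apply: block_index_ord.
      have := enum_valP (Ordinal m0); have := enum_valP (Ordinal m1).
      by rewrite !inE => /eqP -> /eqP ->.
    move=> [_ /(_ (enum_valP _))[a [b [/enum_val_inj -> /enum_val_inj ->]]]].
    by move: p'A; rewrite inE => /asboolP; apply.
  apply: q_other => [E|[p' p'0 E]|[k [p' p'1 E]]].
  - by apply: pa; rewrite -E.
  - apply: pa => j pj; apply: ra; rewrite E; exact: coag_coarser.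
  - subst r; have [k0 _ H] := frag_isolates pa ra; subst k.
    apply: rA; apply: imset_f; rewrite inE; apply/asboolP => a0 a1.
    exact: H.
rewrite -sumEFin.
rewrite (eq_bigr (fun p' => frag_measure mu ce nuD
    (restr #|block_set p 0| @^-1` [set p']))); last first.
  move=> p'; rewrite inE => /asboolP H; rewrite -q_frag // => E.
  by apply: (H (Ordinal (ltnW m1)) (Ordinal m1)) => //; rewrite E.
rewrite (eq_bigl (@zero_avoids_one _)) => [|p']; last by rewrite inE.
by rewrite frag_measure_fin_split // isolation_rate_le.
Qed.

Hypothesis quick : (\int[nuC]_x mass_sum x = +oo)%E \/ 0 < ck.

(** As long as there are two blocks, block 0 merges with another one at positive
    rate. *)
Lemma coarsening_rate p : p <> part1 ->
  exists r, [/\ p <> r, 0 < q p r & forall i j, p i j -> r i j].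
Proof.
move=> p1.
have blocks : (1 < nblocks p)%N.
  rewrite ltnNge; apply/negP => small; apply: p1; apply: part_eqP => i j.
  split=> // _; apply: block_index_ord.
  have := leq_trans (block_index_lt p i) small.
  have := leq_trans (block_index_lt p j) small.
  by rewrite !ltnS !leqn0 => /eqP -> /eqP ->.
have := joining_rate_gt0 muP ck_ge0 quick blocks.
rewrite /joining_rate -coag_measure_fin_split // => pos.
have [p' m0 p'pos] : exists2 p' : part 'I_(nblocks p), zero_meets p' &
    (0 < coag_measure mu ck nuC (restr (nblocks p) @^-1` [set p']))%E.
  apply: contrapT => H; move: pos; rewrite big1 ?ltxx // => p' m0.
  apply/eqP; rewrite eq_le coag_measure_ge0 // andbT leNgt; apply/negP => lt.
  by apply: H; exists p'.
have p'0 := zero_meets_neq0 m0.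
exists (coag p'); split.
- by move=> /esym; exact: coag_part0.
- by rewrite -lte_fin q_coag.
- exact: coag_coarser.
Qed.

End flows.

(** * The stationary law seen by finitely many points *)

Lemma integral_fin_split (R : realType) d (T : measurableType d)
    (m : {measure set T -> \bar R}) (S : finType) (f : T -> S) (g : S -> R) :
  (forall a, measurable (f @^-1` [set a])) -> (forall a, 0 <= g a) ->
  (\int[m]_x (g (f x))%:E = \sum_a (g a)%:E * m (f @^-1` [set a]))%E.
Proof.
move=> mf g0.
rewrite (eq_integral
  (fun x => \sum_a (g a)%:E * (\1_(f @^-1` [set a]) x)%:E)%E); last first.
  move=> x _; rewrite (bigD1 (f x)) //= indicE mem_set // mule1 big1 ?adde0 //.
  by move=> a /eqP af; rewrite indicE memNset ?mule0 // => /esym.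
rewrite ge0_integral_sum //; first 1 last.
- move=> a; apply: measurable_funeM; apply/measurable_EFinP.
  exact: measurable_indic.
- by move=> a x _; rewrite mule_ge0 ?lee_fin.
apply: eq_bigr => a _; rewrite ge0_integralZl_EFin //.
- by rewrite integral_indic // setIT.
- by apply/measurable_EFinP; exact: measurable_indic.
Qed.

Definition trans (R : realType) n (p : R -> R.-pker (part 'I_n) ~> (part 'I_n))
  (t : R) (a b : part 'I_n) : R := fine (p t a [set b]).

Section trans.
Variables (R : realType) (n : nat).
Variable p : R -> R.-pker (part 'I_n) ~> (part 'I_n).

Lemma transE t a b : p t a [set b] = (trans p t a b)%:E.
Proof.
rewrite /trans fineK // ge0_fin_numE ?measure_ge0 //.
apply: le_lt_trans (ltry 1); rewrite -(prob_kernel (s := p t) a).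
by apply: measure_mono => //; exact: measurable_part.
Qed.

Lemma trans_ge0 t a b : 0 <= trans p t a b.
Proof. by rewrite -lee_fin -transE measure_ge0. Qed.

Lemma trans_sum1 t a : \sum_b trans p t a b = 1.
Proof.
apply: EFin_inj; rewrite -sumEFin -(prob_kernel (s := p t) a).
rewrite (_ : setT = id @^-1` [set b : part 'I_n | xpredT b]); last exact/seteqP.
rewrite measure_fin_split; last by move=> b; exact: measurable_part.
by apply: eq_bigr => b _; rewrite -transE.
Qed.

Lemma trans_CK : transition_semigroup p -> forall s t a b, 0 <= s -> 0 <= t ->
  trans p (s + t) a b = \sum_c trans p s a c * trans p t c b.
Proof.
move=> [_ CK] s t a b s0 t0; apply: EFin_inj; rewrite -transE CK //; last first.
  exact: measurable_part.
rewrite (eq_integral (fun c => (trans p t (id c) b)%:E)) => [|c _]; last first.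
  exact: transE.
rewrite (integral_fin_split (p s a) (g := fun c => trans p t c b)) //.
- by rewrite -sumEFin; apply: eq_bigr => c _; rewrite transE -EFinM mulrC.
- by move=> c; exact: measurable_part.
- by move=> c; exact: trans_ge0.
Qed.

End trans.

Definition act n (s : {perm 'I_n}) (a : part 'I_n) : part 'I_n := part_comap s a.

Lemma act_inj n (s : {perm 'I_n}) : injective (act s).
Proof.
move=> a b E; apply: part_eqP => i j.
rewrite -(permKV s i) -(permKV s j).
by rewrite -[a _ _]/(act s a (s^-1 i) (s^-1 j))%g E.
Qed.

Section extend_perm.
Variable n : nat.

Definition extend_perm (s : {perm 'I_n}) (i : nat) : nat :=
  if insub i is Some j then val (s j) else i.

Lemma extend_permE s (i : 'I_n) : extend_perm s i = s i.
Proof. by rewrite /extend_perm valK. Qed.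

Lemma extend_permK s : cancel (extend_perm s) (extend_perm s^-1).
Proof.
move=> i; rewrite {2}/extend_perm; case: insubP => [j jn <-|ni].
  by rewrite extend_permE permK.
by rewrite /extend_perm insubN.
Qed.

Lemma finite_extend_perm s : finite_perm (extend_perm s).
Proof.
split.
  exists (extend_perm s^-1); first exact: extend_permK.
  by rewrite -{2}(invgK s); exact: extend_permK.
by exists n => // i /= ni; rewrite /extend_perm insubN // -leqNgt.
Qed.

Lemma restr_extend_perm s r :
  restr n (part_perm (extend_perm s) r) = act s (restr n r).
Proof. by apply: part_eqP => i j; rewrite /= !extend_permE. Qed.

End extend_perm.

Section stationary_restriction.
Variables (R : realType) (dO : measure_display) (Omega : measurableType dO).
Variables (Pr : probability Omega R) (Pi : R -> Omega -> part nat).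
Variables (K : R -> R.-pker (part nat) ~> (part nat)).
Variable rho : probability (part nat) R.
Hypothesis Pi_exch : exchangeable_process Pr Pi.
Hypothesis rho_stat : stationary K rho.
Variables (n : nat) (q : part 'I_n -> part 'I_n -> R).
Variable p : R -> R.-pker (part 'I_n) ~> (part 'I_n).
Hypothesis p_markov : markov_process Pr (fun t w => restr n (Pi t w)) p.
Hypothesis K_p : forall t x A, 0 <= t -> measurable A ->
  K t x (restr n @^-1` A) = p t (restr n x) A.
Hypothesis p_rates : has_rates p q.

Definition restr_law (a : part 'I_n) : R := fine (rho (restr n @^-1` [set a])).

Lemma restr_lawE a : rho (restr n @^-1` [set a]) = (restr_law a)%:E.
Proof. by rewrite /restr_law fineK ?fin_num_measure //; exact: measurable_cyl. Qed.

Lemma restr_law_ge0 a : 0 <= restr_law a.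
Proof. by rewrite -lee_fin -restr_lawE measure_ge0. Qed.

Lemma restr_law_event (D : pred (part 'I_n)) :
  rho (restr n @^-1` [set a | D a]) = (\sum_(a | D a) restr_law a)%:E.
Proof.
rewrite (measure_fin_split rho) => [|a]; last exact: measurable_cyl.
by rewrite -sumEFin; apply: eq_bigr => a _; exact: restr_lawE.
Qed.

Lemma restr_law_sum1 : \sum_a restr_law a = 1.
Proof.
apply: EFin_inj; rewrite -restr_law_event.
by rewrite (_ : restr n @^-1` _ = setT) ?probability_setT //; exact/seteqP.
Qed.

Lemma restr_law_stationary t b : 0 <= t ->
  \sum_a restr_law a * trans p t a b = restr_law b.
Proof.
move=> t0; apply: EFin_inj; rewrite -restr_lawE -(rho_stat t0); last first.
  exact: measurable_cyl.
rewrite (eq_integral (fun x => (trans p t (restr n x) b)%:E)); last first.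
  by move=> x _; rewrite K_p ?transE //; exact: measurable_part.
rewrite (integral_fin_split rho (g := fun c => trans p t c b)).
- rewrite -sumEFin; apply: eq_bigr => c _; rewrite EFinM muleC.
  by congr (_ * _)%E; exact/esym/restr_lawE.
- by move=> c; exact: measurable_cyl.
- by move=> c; exact: trans_ge0.
Qed.

Definition state_law (t : R) (a : part 'I_n) : R :=
  fine (Pr ((fun w => restr n (Pi t w)) @^-1` [set a])).

Lemma measurable_state t (D : set (part 'I_n)) : 0 <= t ->
  measurable ((fun w => restr n (Pi t w)) @^-1` D).
Proof.
move=> t0; rewrite -[X in measurable X]setTI.
have [_ mPi _] := p_markov; apply: mPi => //; exact: measurable_part.
Qed.

Lemma state_lawE t a : 0 <= t ->
  Pr ((fun w => restr n (Pi t w)) @^-1` [set a]) = (state_law t a)%:E.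
Proof.
move=> t0; rewrite /state_law fineK // fin_num_measure //.
exact: measurable_state.
Qed.

Lemma state_law_sum1 t : 0 <= t -> \sum_a state_law t a = 1.
Proof.
move=> t0; apply: EFin_inj.
rewrite -(probability_setT Pr) -sumEFin.
rewrite (_ : setT = (fun w => restr n (Pi t w)) @^-1`
  [set a : part 'I_n | xpredT a]); last exact/seteqP.
rewrite (measure_fin_split Pr) => [|a]; last exact: measurable_state.
by apply: eq_bigr => a _; rewrite -state_lawE.
Qed.

Lemma state_law_step s t b : 0 <= s -> 0 <= t ->
  state_law (s + t) b = \sum_a state_law s a * trans p t a b.
Proof.
move=> s0 t0; have [_ _ mk] := p_markov; apply: EFin_inj.
rewrite -state_lawE ?addr_ge0 //.
have past1 : past (fun t w => restr n (Pi t w)) s setT.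
  rewrite -setC0; move: (@sigma_algebra0 Omega setT).
  by move=> H; exact: (sigma_algebraC (H _)).
have := mk s t setT [set b] s0 t0 past1 (measurable_part _).
rewrite setTI => ->.
rewrite (eq_integral (fun w => (trans p t (restr n (Pi s w)) b)%:E)); last first.
  by move=> w _; rewrite transE.
rewrite (integral_fin_split Pr (g := fun c => trans p t c b)).
- rewrite -sumEFin; apply: eq_bigr => c _; rewrite EFinM muleC.
  by congr (_ * _)%E; rewrite -state_lawE.
- by move=> c; exact: measurable_state.
- by move=> c; exact: trans_ge0.
Qed.

Lemma state_law_act s t a : 0 <= t -> state_law t (act s a) = state_law t a.
Proof.
move=> t0; apply: EFin_inj; rewrite -!state_lawE //.
have := Pi_exch (finite_extend_perm s) (m := 1) (t := fun=> t)
  (A := fun=> restr n @^-1` [set act s a]) (fun=> t0)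
  (fun=> measurable_cyl _).
have bigcap1 (F : set Omega) : \bigcap_(i in [set: 'I_1]) F = F.
  by rewrite bigcap_const //; exists ord0.
rewrite !bigcap1 => <-; congr (Pr _).
apply/seteqP; split=> w /=; rewrite restr_extend_perm; first by move/act_inj.
by move=> ->.
Qed.

(** The laws of the chain at the times [k * T] are exchangeable and converge to
    the stationary law, because every state leads to the one-block partition. *)
Lemma restr_law_act s a :
  (forall b, leads (trans p) b part1) -> restr_law (act s a) = restr_law a.
Proof.
move=> reach; have [semi _ _] := p_markov.
have rate b c : b <> c -> trans p h b c / h @[h --> 0^'+] --> q b c.
  exact: p_rates.
have [T [e [T0 e0 Te]]] :=
  leads_common_time (@trans_ge0 _ _ p) (@trans_sum1 _ _ p) (trans_CK semi)
    rate reach.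
have lim b : (fun k : nat => state_law (T *+ k) b) @ \oo --> restr_law b.
  apply: (doeblin_cvg (Q := trans p T) (u := fun k => state_law (T *+ k))
    (@trans_ge0 _ _ p T) (@trans_sum1 _ _ p T) Te e0 restr_law_sum1
    (fun b => restr_law_stationary b (ltW T0))).
    by move=> k; rewrite state_law_sum1 // mulrn_wge0 // ltW.
  by move=> k c; rewrite mulrSr state_law_step ?mulrn_wge0 // ltW.
apply: (cvg_unique _ (lim (act s a))) => //.
suff -> : (fun k : nat => state_law (T *+ k) (act s a)) =
  (fun k => state_law (T *+ k) a) by exact: lim.
by apply/funext => k; rewrite state_law_act // mulrn_wge0 // ltW.
Qed.

End stationary_restriction.

(** * Bounds for exchangeable laws *)

Definition cls n (a : part 'I_n) (i : 'I_n) : {set 'I_n} :=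
  [set j | `[< a i j >]]%SET.

Lemma in_cls n (a : part 'I_n) i j : (j \in cls a i) = `[< a i j >].
Proof. by rewrite inE. Qed.

Lemma singles_act n (s : {perm 'I_n}) (a : part 'I_n) :
  singles (act s a) = (s @^-1: singles a)%SET.
Proof.
apply/setP => i; rewrite [in RHS]inE; apply/singlesP/singlesP => H j aij.
  by rewrite -(permKV s j) (H (s^-1 j)%g) //= permKV.
by apply: (@perm_inj _ s); apply: H.
Qed.

Lemma cls_act n (s : {perm 'I_n}) (a : part 'I_n) i :
  cls (act s a) i = (s @^-1: cls a (s i))%SET.
Proof. by apply/setP => j; rewrite !inE. Qed.

Section exchangeable_bounds.
Variables (R : realType) (n : nat) (r : part 'I_n.+1 -> R).
Hypothesis r_ge0 : forall a, 0 <= r a.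
Hypothesis r_sum1 : \sum_a r a = 1.
Hypothesis r_act : forall s a, r (act s a) = r a.

Lemma law_le1 (D : pred (part 'I_n.+1)) : \sum_(a | D a) r a <= 1.
Proof. by rewrite -r_sum1 [leRHS](bigID D) /= lerDl sumr_ge0. Qed.

Lemma law_act (s : 'S_n.+1) (D : pred (part 'I_n.+1)) :
  \sum_(a | D a) r a = \sum_(a | D (act s a)) r a.
Proof.
rewrite (reindex_inj (@act_inj _ s)) /=.
by apply: eq_bigr => a _; rewrite r_act.
Qed.

Lemma single_law i j :
  \sum_(a | i \in singles a) r a = \sum_(a | j \in singles a) r a.
Proof.
rewrite (law_act (tperm i j)); apply: eq_bigl => a.
by rewrite singles_act inE tpermL.
Qed.

(** By symmetry a given point is isolated as often as a uniformly chosen one, and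
    fewer than [m] of the [n + 1] points are isolated. *)
Lemma few_singles i m :
  n.+1%:R * \sum_(a | (i \in singles a) && (#|singles a| < m)%N) r a <= m%:R.
Proof.
pose F i := \sum_(a | (i \in singles a) && (#|singles a| < m)%N) r a.
have FE j : F j = F i.
  rewrite /F (law_act (tperm j i)); apply: eq_bigl => a.
  by rewrite singles_act inE tpermL card_preimset //; exact: perm_inj.
have -> : n.+1%:R * F i = \sum_j F j.
  by rewrite (eq_bigr _ (fun j _ => FE j)) sumr_const card_ord mulr_natl.
have -> : \sum_j F j = \sum_(a | (#|singles a| < m)%N) r a *+ #|singles a|.
  rewrite /F; under eq_bigr do rewrite big_andbC big_mkcondr /=.
  rewrite exchange_big; apply: eq_bigr => a _.
  by rewrite -big_mkcond sumr_const.
apply: (@le_trans _ _ (\sum_(a | (#|singles a| < m)%N) r a * m%:R)).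
  apply: ler_sum => a /ltnW am; rewrite -[r a *+ _]mulr_natr ler_wpM2l //.
  by rewrite ler_nat.
by rewrite -mulr_suml -[leRHS]mul1r ler_wpM2r // law_le1.
Qed.

(** By symmetry the block of [i] contains each other point equally often, and the
    number of points that it contains is at most [c]. *)
Lemma small_block i j c : i != j -> 0 <= c ->
  n%:R * \sum_(a | (j \in cls a i) && (#|cls a i|%:R <= c)) r a <= c.
Proof.
move=> ij c0.
pose G j := \sum_(a | (j \in cls a i) && (#|cls a i|%:R <= c)) r a.
have GE k : k != i -> G k = G j.
  move=> ki; rewrite /G (law_act (tperm k j)); apply: eq_bigl => a.
  rewrite !cls_act inE tpermL tpermD // 1?eq_sym //.
  by rewrite card_preimset //; exact: perm_inj.
have -> : n%:R * G j = \sum_(k | k != i) G k.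
  by rewrite (eq_bigr _ GE) sumr_const cardC1 card_ord mulr_natl.
apply: (@le_trans _ _ (\sum_k G k)).
  rewrite [leRHS](bigID (fun k => k != i)) /= lerDl.
  by apply: sumr_ge0 => k _; exact: sumr_ge0.
have -> : \sum_k G k = \sum_(a | #|cls a i|%:R <= c) r a *+ #|cls a i|.
  rewrite /G; under eq_bigr do rewrite big_andbC big_mkcondr /=.
  rewrite exchange_big; apply: eq_bigr => a _.
  by rewrite -big_mkcond sumr_const.
apply: (@le_trans _ _ (\sum_(a | #|cls a i|%:R <= c) r a * c)).
  by apply: ler_sum => a ac; rewrite -[r a *+ _]mulr_natr ler_wpM2l.
by rewrite -mulr_suml -[leRHS]mul1r ler_wpM2r // law_le1.
Qed.

(** Comparing the flow out of the isolated states with the flow into them. *)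
Lemma isolated_le (q : part 'I_n.+1 -> part 'I_n.+1 -> R) (L M : R) m i :
  0 <= L -> 0 < M ->
  (forall D : pred (part 'I_n.+1),
    \sum_(a | D a) \sum_(b | ~~ D b) r a * q a b =
    \sum_(a | ~~ D a) \sum_(b | D b) r a * q a b) ->
  (forall a b, a <> b -> 0 <= q a b) ->
  (forall a : part 'I_n.+1, ord0 \in singles a -> (m <= #|singles a|)%N ->
     M <= \sum_(b : part 'I_n.+1 | ord0 \notin singles b) q a b) ->
  (forall a : part 'I_n.+1, ord0 \notin singles a ->
     \sum_(b : part 'I_n.+1 | ord0 \in singles b) q a b <= L) ->
  \sum_(a | i \in singles a) r a <= L / M + m%:R / n.+1%:R.
Proof.
move=> L0 M0 bal q0 out inn; rewrite (single_law i ord0).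
rewrite (bigID (fun a => (#|singles a| < m)%N)) /= addrC lerD //; last first.
  by rewrite ler_pdivlMr // mulrC few_singles.
rewrite ler_pdivlMr // mulr_suml.
have bal' := bal (fun a => ord0 \in singles a).
apply: (@le_trans _ _
  (\sum_(a | ord0 \in singles a) \sum_(b | ord0 \notin singles b) r a * q a b)).
  rewrite [leRHS](bigID (fun a => (#|singles a| < m)%N)) /= -[leLHS]add0r lerD //.
    apply: sumr_ge0 => a /andP[a0 _]; apply: sumr_ge0 => b b0.
    by rewrite mulr_ge0 // q0 // => E; move: b0; rewrite -E a0.
  apply: ler_sum => a /andP[a0 am]; rewrite -mulr_sumr ler_wpM2l // out //.
  by rewrite leqNgt.
rewrite bal'; apply: (@le_trans _ _ (\sum_(a | ord0 \notin singles a) r a * L)).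
  by apply: ler_sum => a a0; rewrite -mulr_sumr ler_wpM2l // inn.
by rewrite -mulr_suml -[leRHS]mul1r ler_wpM2r // law_le1.
Qed.

End exchangeable_bounds.

(** * Asymptotic frequencies *)

Section frequencies.
Variable R : realType.

(** The prefix has [n + i + 1] points so that [i] is always one of them; the block
    of [i] fills a proportion at most [1 / (k + 1)] of it. *)
Definition sparse (i k n : nat) : set (part nat) :=
  restr (n + i).+1 @^-1`
    [set a | #|cls a (inord i)|%:R <= (n + i).+1%:R / k.+1%:R :> R].

Definition null_freq (i : nat) : set (part nat) :=
  \bigcap_k \bigcup_M \bigcap_(n in [set n | (M <= n)%N]) sparse i k n.

Lemma measurable_sparse i k n : measurable (sparse i k n).
Proof. exact: measurable_cyl. Qed.

Lemma measurable_sparse_tail i k M :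
  measurable (\bigcap_(n in [set n | (M <= n)%N]) sparse i k n).
Proof. by apply: bigcap_measurableType => n _; exact: measurable_sparse. Qed.

Lemma measurable_null_freq i : measurable (null_freq i).
Proof.
apply: bigcap_measurableType => k _; apply: bigcup_measurable => M _.
exact: measurable_sparse_tail.
Qed.

Lemma card_prefix (p : part nat) i n : (i <= n)%N ->
  #|` fset_set ([set j | p i j] `&` `I_n.+1)|%fset =
  #|cls (restr n.+1 p) (inord i)|.
Proof.
move=> i_n; rewrite cardE -(size_map val); apply: perm_size; apply: uniq_perm.
- exact: fset_uniq.
- by rewrite map_inj_uniq ?enum_uniq //; exact: val_inj.
have fin : finite_set ([set j | p i j] `&` `I_n.+1).
  by apply: sub_finite_set (finite_II n.+1) => j [].
move=> j; rewrite in_fset_set //; apply/idP/mapP => [/set_mem [pij jn]|[l + ->]].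
  exists (Ordinal (jn : (j < n.+1)%N)) => //.
  by rewrite mem_enum in_cls; apply/asboolP; rewrite /= inordK.
rewrite mem_enum in_cls => /asboolP /=; rewrite inordK // => pil.
by apply/mem_set; split=> //=.
Qed.

Lemma has_freq0P (p : part nat) i :
  has_freq [set j | p i j] (0 : R) <-> null_freq i p.
Proof.
rewrite /has_freq -(cvg_shiftn i.+1).
pose f n : R := #|cls (restr (n + i).+1 p) (inord i)|%:R / (n + i).+1%:R.
rewrite (_ : (fun n => _) = f); last first.
  by apply/funext => n; rewrite /f addnS card_prefix // leq_addl.
have f0 n : `|0 - f n| = f n by rewrite sub0r normrN ger0_norm // divr_ge0.
have sparseE k n : sparse i k n p <-> f n <= k.+1%:R^-1.
  by rewrite /sparse /= /f ler_pdivrMr // mulrC.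
split=> [/cvgrPdist_le H k _|H].
  have k0 : 0 < (k.+1%:R^-1 : R) by rewrite invr_gt0.
  have [M _ HM] := H _ k0; exists M => // n /= Mn; apply/sparseE.
  by rewrite -f0; exact: HM.
apply/cvgrPdist_le => e e0.
have [M _ HM] := H (Num.truncn e^-1) I; exists M => // n /= Mn.
rewrite f0; apply: le_trans (_ : (Num.truncn e^-1).+1%:R^-1 <= _).
  by apply/sparseE; exact: HM.
by rewrite invf_ple ?posrE // ltW // truncnS_gt.
Qed.

Lemma dust_nonemptyE :
  [set p | dust R p !=set0] = \bigcup_i null_freq i.
Proof.
have blockE (p : part nat) i : block p (block_index p i) = [set j | p i j].
  apply/seteqP; split=> j /=; rewrite /block /=.
    by move=> /esym; exact: block_index_nat.
  by move=> /block_index_sim.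
apply/seteqP; split=> [p [i [k /= fk ik]]|p [i _ fi]].
  by exists i => //; apply/has_freq0P; rewrite -blockE ik.
exists i; exists (block_index p i) => //=.
by rewrite blockE; apply/has_freq0P.
Qed.

End frequencies.

(** * Dust has probability zero *)

Section no_dust.
Variables (R : realType) (rho : probability (part nat) R).
Hypothesis rho_act : forall n (s : {perm 'I_n}) a,
  restr_law rho (act s a) = restr_law rho a.

(** Given [i] and [j], exchangeability makes the block of [i] as likely to contain
    [j] as any other point, so a block of frequency 0 contains [j] with
    probability 0. *)
Lemma null_freq_sim i j : i != j ->
  rho (null_freq R i `&` [set p | p i j]) = 0%E.
Proof.
move=> ij.
pose tail k M := \bigcap_(n in [set n | (M <= n)%N]) sparse R i k n `&`
  [set p : part nat | p i j].
have mtail k M : measurable (tail k M).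
  by apply: measurableI; [exact: measurable_sparse_tail|exact: measurable_sim].
have tail_le k M : (rho (tail k M) <= (2 / k.+1%:R)%:E)%E.
  (* large enough for the tail to apply and for [j] to be among the points *)
  pose n := (M + j).+1; pose N := (n + i)%N.
  have iN : (i < N.+1)%N by rewrite ltnS leq_addl.
  have jN : (j < N.+1)%N.
    by rewrite ltnS /N /n (leq_trans _ (leq_addr _ _)) // leqW // leq_addl.
  pose i' : 'I_N.+1 := inord i; pose j' : 'I_N.+1 := inord j.
  have ij' : i' != j' by rewrite -val_eqE /= !inordK.
  pose D := [set a : part 'I_N.+1 |
    (j' \in cls a i') && (#|cls a i'|%:R <= N.+1%:R / k.+1%:R :> R)].
  apply: (@le_trans _ _ (rho (restr N.+1 @^-1` D))).
    apply: (measure_mono rho) => //; first exact: measurable_cyl.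
    move=> p [Hp pij]; apply/andP; split.
      by rewrite in_cls; apply/asboolP; rewrite /= !inordK.
    by apply: (Hp n); rewrite /= /n leqW // leq_addr.
  rewrite restr_law_event lee_fin.
  have c0 : 0 <= N.+1%:R / k.+1%:R :> R by rewrite divr_ge0.
  have := small_block (@restr_law_ge0 _ rho N.+1) (@restr_law_sum1 _ rho N.+1)
    (@rho_act N.+1) ij' c0.
  set S := \sum_(a | _) _ => NS.
  have N0 : 0 < N%:R :> R by rewrite ltr0n /N /n addSn.
  rewrite -(ler_pM2l N0); apply: le_trans NS _.
  rewrite mulrA ler_pM2r ?invr_gt0 // -natrM ler_nat.
  by rewrite muln2 -addnn -addn1 leq_add2l -(ltr0n R).
have lim k : (rho (\bigcup_M tail k M) <= (2 / k.+1%:R)%:E)%E.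
  have := nondecreasing_cvg_mu (mu := rho) (mtail k) _ _.
  move=> /(_ (bigcup_measurable (fun M _ => mtail k M))) lim.
  rewrite -(cvg_lim _ (lim _)) //.
    apply: lime_le; last by apply: nearW => M; exact: tail_le.
    apply: ereal_nondecreasing_is_cvgn => M M' MM'.
    apply: (measure_mono rho) => // p [H pij]; split=> // n /= M'n.
    by apply: H; exact: leq_trans MM' M'n.
  move=> M M' MM'; apply/subsetPset => p [H pij]; split=> // n /= M'n.
  by apply: H; exact: leq_trans MM' M'n.
have mZ : measurable (null_freq R i `&` [set p | p i j]).
  by apply: measurableI; [exact: measurable_null_freq|exact: measurable_sim].
have bound k : (rho (null_freq R i `&` [set p | p i j]) <= (2 / k.+1%:R)%:E)%E.
  apply: le_trans (lim k); apply: (measure_mono rho) => //.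
    exact: bigcup_measurable.
  by move=> p [/(_ k I) [M _ H] pij]; exists M.
apply/eqP; rewrite -measure_le0; apply/lee_addgt0Pr => e e0; rewrite add0e.
apply: le_trans (bound (Num.truncn (2 / e))) _.
by rewrite lee_fin ler_pdivrMr // mulrC -ler_pdivrMr // ltW // truncnS_gt.
Qed.

Hypothesis singles_vanish : forall e : R, 0 < e ->
  \forall n \near \oo, forall i : 'I_n.+1,
    \sum_(a | i \in singles a) restr_law rho a <= e.

Lemma measurable_alone i : measurable [set p : part nat | alone p i].
Proof.
rewrite (_ : [set p : part nat | alone p i] =
    \bigcap_(j in [set j | j <> i]) ~` [set p : part nat | p i j]).
  by apply: bigcap_measurableType => j _; apply: measurableC; exact: measurable_sim.
apply/seteqP; split=> [p pi j ji /pi //|p H j pij].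
by apply: contrapT => ji; exact: (H j ji).
Qed.

Lemma alone_null i : rho [set p | alone p i] = 0%E.
Proof.
apply/eqP; rewrite -measure_le0; apply/lee_addgt0Pr => e e0; rewrite add0e.
have [N _ HN] := singles_vanish e0.
pose n := maxn N i.
have i_n : (i < n.+1)%N by rewrite ltnS leq_maxr.
apply: (@le_trans _ _
  (rho (restr n.+1 @^-1` [set a | (inord i : 'I_n.+1) \in singles a]))).
  apply: (measure_mono rho); [exact: measurable_alone|exact: measurable_cyl|].
  move=> p pi; apply/singlesP => j /=; rewrite inordK // => /pi E.
  by apply: val_inj; rewrite /= inordK.
by rewrite restr_law_event lee_fin; apply: HN; rewrite /= leq_maxl.
Qed.

Lemma dust_null : rho [set p | dust R p !=set0] = 0%E.
Proof.
rewrite dust_nonemptyE; apply/negligibleP.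
  by apply: bigcup_measurable => i _; exact: measurable_null_freq.
apply: negligible_bigcup => i.
apply: (@negligibleS _ _ _ _ ([set p | alone p i] `|`
    \bigcup_j (if i == j then set0 else null_freq R i `&` [set p | p i j]))).
  move=> p Zp; have [pi|npi] := pselect (alone p i); first by left.
  right; apply: contrapT => H; apply: npi => j pij; apply: contrapT => ji.
  by apply: H; exists j => //; case: eqP => // E; case: ji.
apply: negligibleU.
  by apply/negligibleP; [exact: measurable_alone|exact: alone_null].
apply: negligible_bigcup => j; case: ifPn => [_|ij]; first exact: negligible_set0.
apply/negligibleP; last exact: null_freq_sim.
by apply: measurableI; [exact: measurable_null_freq|exact: measurable_sim].
Qed.

End no_dust.

(** Each step relates more pairs of points, so finitely many steps suffice. *)
Lemma leads_part1 (R : realType) n (P : R -> part 'I_n -> part 'I_n -> R)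
    (q : part 'I_n -> part 'I_n -> R) :
  (forall t a b, 0 <= P t a b) -> (forall t a, \sum_b P t a b = 1) ->
  (forall s t a b, 0 <= s -> 0 <= t -> P (s + t) a b = \sum_c P s a c * P t c b) ->
  (forall a b, a <> b -> P h a b / h @[h --> 0^'+] --> q a b) ->
  (forall a, a <> part1 ->
    exists b, [/\ a <> b, 0 < q a b & forall i j, a i j -> b i j]) ->
  forall a, leads P a part1.
Proof.
move=> P0 P1 CK rate up a.
pose N (a : part 'I_n) := [set ij : 'I_n * 'I_n | ~~ `[< a ij.1 ij.2 >]]%SET.
have [k] := ubnP #|N a|; elim: k a => // k IH a ak.
have [->|a1] := pselect (a = part1); first exact: (leads_refl P0 P1 CK rate).
have [b [ab qab coarser]] := up a a1.
apply: (leads_trans P0 CK (rate_leads P0 rate ab qab)).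
apply: IH; move: ak; rewrite ltnS; apply: leq_trans.
apply: proper_card; apply/properP; split.
  apply/fintype.subsetP => ij; rewrite !inE; apply: contra => /asboolP aij.
  by apply/asboolP; exact: coarser.
apply: contrapT => H; apply: ab; apply: part_eqP => i j; split; first exact: coarser.
move=> bij; apply: contrapT => aij; apply: H; exists (i, j).
  by rewrite inE /=; apply/asboolPn.
by rewrite inE /= negbK; apply/asboolP.
Qed.

Theorem theorem10 (R : realType)
    (ck : R) (nuC : {measure set (massp R) -> \bar R})
    (ce : R) (nuD : {measure set (massp R) -> \bar R})
    (dO : measure_display) (Omega : measurableType dO)
    (Pr : probability Omega R)
    (Pi : R -> Omega -> part nat)
    (K : R -> R.-pker (part nat) ~> (part nat))
    (q : forall n : nat, part 'I_n -> part 'I_n -> R)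
    (rho : probability (part nat) R) :
  characteristics ck nuC ce nuD ->
  EFC_process Pr Pi K q ->
  rates_have_characteristics q ck nuC ce nuD ->
  (\int[nuC]_x mass_sum x = +oo)%E \/ 0 < ck ->
  stationary K rho ->
  rho [set p | dust R p !=set0] = 0%E.
Proof.
move=> [ck0 ce0 _ _ _ nuD_fin] [Pi_exch _ Pi_restr _ _] [mu muP muq] quick stat.
have chain n : exists p : R -> R.-pker (part 'I_n) ~> (part 'I_n),
    [/\ markov_process Pr (fun t w => restr n (Pi t w)) p,
      (forall t x A, 0 <= t -> measurable A ->
         K t x (restr n @^-1` A) = p t (restr n x) A) &
      has_rates p (q n)] := Pi_restr n.
have q_ge0 n (a b : part 'I_n) : a <> b -> 0 <= q n a b.
  have [p [_ _ rate]] := chain n.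
  by apply: (rate_ge0 (@trans_ge0 _ _ p)); exact: rate.
have exch n (s : {perm 'I_n}) a : restr_law rho (act s a) = restr_law rho a.
  case: n s a => [|n] s a.
    by congr (restr_law rho _); apply: part_eqP => -[].
  have [p [mk Kp rate]] := chain n.+1.
  apply: (restr_law_act Pi_exch stat mk Kp rate).
  have [semi _ _] := mk.
  apply: (leads_part1 (@trans_ge0 _ _ p) (@trans_sum1 _ _ p) (trans_CK semi)
    rate).
  apply: (coarsening_rate muP ck0 _ quick).
  by move=> a' p' p'0; have [H _ _] := muq n.+1 a'; exact: H.
have balance n (D : pred (part 'I_n)) :
    \sum_(a | D a) \sum_(b | ~~ D b) restr_law rho a * q n a b =
    \sum_(a | ~~ D a) \sum_(b | D b) restr_law rho a * q n a b.
  have [p [mk Kp rate]] := chain n.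
  apply: (stationary_balance (@trans_sum1 _ _ p) rate) => t b.
  exact: (restr_law_stationary stat Kp).
apply: dust_null => // e e0.
have L_fin : (isolation_bound ce nuD < +oo)%E.
  by rewrite /isolation_bound lte_add_pinfty // -EFinM ltry.
have L_ge0 : (0 <= isolation_bound ce nuD)%E.
  exact: (isolation_bound_ge0 muP).
pose L := fine (isolation_bound ce nuD).
have LE : isolation_bound ce nuD = L%:E by rewrite /L fineK // ge0_fin_numE.
have L0 : 0 <= L by rewrite -lee_fin -LE.
(* the flow balance and the scarcity of singletons contribute [e / 2] each *)
pose M := L / (e / 2) + 1.
have e2 : 0 < e / 2 by rewrite divr_gt0.
have M0 : 0 < M by rewrite ltr_wpDl // divr_ge0 // ltW.
have [m Mm] := joining_rate_unbounded muP ck0 quick M.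
exists (Num.truncn (m%:R / (e / 2))) => // n /= nm i.
apply: le_trans (isolated_le (@restr_law_ge0 _ rho n.+1)
  (@restr_law_sum1 _ rho n.+1) (exch n.+1) i L0 M0 (balance n.+1) (q_ge0 n.+1)
  (m := m) _ _) _.
- move=> a a0 ma; rewrite -lee_fin; apply: le_trans Mm _.
  apply: le_trans (outflow_ge muP _ (q_ge0 n.+1) a0).
    apply: joining_rate_mono => //; apply: leq_trans ma _; exact: card_singles_le.
  by move=> a' p' p'0; have [H _ _] := muq n.+1 a'; exact: H.
- move=> a a0; rewrite -lee_fin -LE.
  apply: (inflow_le muP ce0 _ _ (q_ge0 n.+1) a0).
  + by move=> a' k p' p'1; have [_ H _] := muq n.+1 a'; exact: H.
  + by move=> a' r; have [_ _ H] := muq n.+1 a'; exact: H.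
rewrite (splitr e) lerD //.
  by rewrite ler_pdivrMr // mulrC -ler_pdivrMr // /M lerDl.
rewrite ler_pdivrMr // mulrC -ler_pdivrMr //.
by apply: le_trans (ltW (truncnS_gt _)) _; rewrite ler_nat ltnS.
Qed.
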